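(* Let $0<\alpha<1$, let $L(x,v)=\frac12 m v^2-U(x)$ be a natural Lagrangian (with mass $m>0$ and smooth potential $U:\mathbb{R}\to\mathbb{R}$), and let $H(x,p)=\frac{1}{2m}p^2+U(x)$ be the associated Hamiltonian, with $p=\partial_2L(x,v)=mv$. Let $(x(t),p(t))_{t\ge0}$ be a solution of the classical Hamiltonian equations $$\frac{d}{dt}x(t)=\partial_2H(x(t),p(t)),\qquad \frac{d}{dt}p(t)=-\partial_1H(x(t),p(t)),$$ and let $$x_\alpha(t)=\int_0^\infty p_t(\tau)\,x(\tau)\,d\tau,\qquad p_\alpha(t)=\int_0^\infty p_t(\tau)\,p(\tau)\,d\tau ,$$ where $p_t$ is the distribution of the internal time $S(t)$. If $x_\alpha$ is a solution of the causal fractional Euler-Lagrange equation associated with $L$, $$\partial_1L\big(x_\alpha(t),{}_0\mathcal{D}_t^\alpha x_\alpha(t)\big)-{}_0\mathcal{D}_t^\alpha\,\partial_2L\big(x_\alpha(t),{}_0\mathcal{D}_t^\alpha x_\alpha(t)\big)=0\qquad(t>0),$$ then for all $t>0$ $$\partial_1 H(x_\alpha(t),p_\alpha(t))=\int_0^\infty p_t(\tau)\,\partial_1 H(x(\tau),p(\tau))\,d\tau,\qquad \partial_2 H(x_\alpha(t),p_\alpha(t))=\int_0^\infty p_t(\tau)\,\partial_2 H(x(\tau),p(\tau))\,d\tau .$$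
   Context: $\partial_i$ denotes the partial derivative with respect to the $i$-th argument. Internal time: for $0<\alpha<1$, $\{S(t)\}_{t\ge0}$ is the increasing (hitting-time) process arising as the scaling limit of the counting process associated with i.i.d. nonnegative waiting times whose density satisfies $\rho(t)\sim a\,t^{-1-\alpha}$ as $t\to\infty$, $a>0$. For $t>0$, $p_t$ denotes its one-dimensional distribution (a probability density on $(0,\infty)$), which is characterized by $$\int_0^\infty e^{-v\tau}p_t(\tau)\,d\tau=\mathbb{E}[e^{-vS(t)}]=E_\alpha(-v t^\alpha),\qquad v\ge 0,$$ where $E_\alpha(z)=\sum_{k\ge0} z^k/\Gamma(1+\alpha k)$ is the one-parameter Mittag-Leffler function; consequently $\int_0^\infty e^{-wt}p_t(\tau)\,dt=w^{\alpha-1}e^{-\tau w^\alpha}$ for $w>0$. At $t=0$ the distribution is the point mass at $0$, so $x_\alpha(0)=x(0)$ and $p_\alpha(0)=p(0)$. Thus $x_\alpha(t)=\mathbb{E}[x(S(t))]$ and $p_\alpha(t)=\mathbb{E}[p(S(t))]$. (The letter $p$ without time subscript is the momentum variable.) The left Caputo derivative is $${}_a\mathcal{D}_t^\alpha f(t)=\frac{1}{\Gamma(1-\alpha)}\int_a^t (t-\tau)^{-\alpha}f'(\tau)\,d\tau ,$$ used here with $a=0$; ${}_0\mathcal{D}_t^\alpha\,\partial_2L(x_\alpha(t),{}_0\mathcal{D}_t^\alpha x_\alpha(t))$ means the left Caputo derivative of the function $t\mapsto\partial_2L(x_\alpha(t),{}_0\mathcal{D}_t^\alpha x_\alpha(t))$.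 *)

(* Defs.v *)
From HB Require Import structures.
From mathcomp Require Import all_boot all_order all_algebra.
From mathcomp Require Import all_classical all_reals all_analysis.

Set Implicit Arguments.
Unset Strict Implicit.
Unset Printing Implicit Defensive.

Import Order.TTheory GRing.Theory Num.Theory.
Import numFieldNormedType.Exports.

Local Open Scope classical_set_scope.
Local Open Scope ring_scope.

Section FractionalMechanics.
Context {R : realType}.

Local Notation mu := (@lebesgue_measure R).

Definition partial1 (F : R -> R -> R) (u v : R) : R := derive1 (fun z => F z v) u.
Definition partial2 (F : R -> R -> R) (u v : R) : R := derive1 (fun z => F u z) v.

Definition smooth (U : R -> R) : Prop :=
  forall (n : nat) (u : R), derivable (derive1n n U) u 1.

(* Euler's integral, meaningful for z > 0; only such arguments are used. *)
Definition Gamma (z : R) : R :=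
  \int[mu]_(s in `]0, +oo[) (s `^ (z - 1) * expR (- s)).

Definition mittag_leffler (alpha z : R) : R :=
  limn (series (fun k : nat => z ^+ k / Gamma (1 + alpha * k%:R))).

(* [dens t] is a density on (0, +oo) of the law of the internal time S(t), for
   every t > 0. Only the one-dimensional laws of S are involved, and each is
   determined by its Laplace transform E[exp(- v S(t))] = E_alpha(- v t^alpha);
   its density is thus fixed up to a null set, for each t separately. *)
Definition internal_time_density (alpha : R) (dens : R -> R -> R) : Prop :=
  forall t : R, 0 < t ->
  [/\ measurable_fun (`]0, +oo[ : set R) (dens t),
      forall tau, 0 < tau -> 0 <= dens t tau,
      (\int[mu]_(tau in `]0%R, +oo[) (dens t tau)%:E = 1)%E
    & forall v, 0 <= v ->
        \int[mu]_(tau in `]0, +oo[) (expR (- (v * tau)) * dens t tau)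
        = mittag_leffler alpha (- (v * t `^ alpha))].

Definition has_internal_mean (dens : R -> R -> R) (f : R -> R) : Prop :=
  forall t : R, 0 < t ->
    mu.-integrable `]0, +oo[ (fun tau => (dens t tau * f tau)%:E).

(* E[f(S(t))]; the law of S(0) is the point mass at 0. *)
Definition internal_mean (dens : R -> R -> R) (f : R -> R) (t : R) : R :=
  if 0 < t then \int[mu]_(tau in `]0, +oo[) (dens t tau * f tau) else f 0.

Definition caputo (a alpha : R) (f : R -> R) (t : R) : R :=
  (Gamma (1 - alpha))^-1 *
  \int[mu]_(tau in `]a, t[) ((t - tau) `^ (- alpha) * derive1 f tau).

(* The formula for [caputo a alpha f t] is meaningful for all t > a: without
   this, the total operators above would return default values. *)
Definition caputo_exists (a alpha : R) (f : R -> R) : Prop :=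
  forall t : R, a < t ->
    derivable f t 1 /\
    mu.-integrable `]a, t[
      (fun tau => ((t - tau) `^ (- alpha) * derive1 f tau)%:E).

Definition causal_Euler_Lagrange_solution
    (alpha : R) (L : R -> R -> R) (y : R -> R) : Prop :=
  let Dy := caputo 0 alpha y in
  let momentum := fun t => partial2 L (y t) (Dy t) in
  [/\ caputo_exists 0 alpha y,
      caputo_exists 0 alpha momentum
    & forall t : R, 0 < t ->
        partial1 L (y t) (Dy t) - caputo 0 alpha momentum t = 0].

Definition natural_Lagrangian (m : R) (U : R -> R) (x v : R) : R :=
  2^-1 * m * v ^+ 2 - U x.

Definition natural_Hamiltonian (m : R) (U : R -> R) (x p : R) : R :=
  (2 * m)^-1 * p ^+ 2 + U x.

(* Solution on [0, +oo). At t = 0 only continuity from the right is required;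
   for a continuously differentiable H the one-sided equations at 0 follow. *)
Definition Hamilton_solution (H : R -> R -> R) (x p : R -> R) : Prop :=
  [/\ {within `[0, +oo[, continuous x},
      {within `[0, +oo[, continuous p}
    & forall t : R, 0 < t ->
        is_derive t 1 x (partial2 H (x t) (p t)) /\
        is_derive t 1 p (- partial1 H (x t) (p t))].

End FractionalMechanics.

(* Main.v *)
Require Import Defs.
From HB Require Import structures.
From mathcomp Require Import all_boot all_order all_algebra.
From mathcomp Require Import all_classical all_reals all_analysis.
From mathcomp Require Import measurable_realfun.
From mathcomp Require Import ring lra.
Import Order.TTheory GRing.Theory Num.Theory.
Import numFieldNormedType.Exports.
Local Open Scope classical_set_scope.
Local Open Scope ring_scope.
Set Implicit Arguments.
Unset Strict Implicit.

(** Write S(t) for the internal time, with density [dens t], and let x, p be a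
    trajectory of the Hamiltonian system. The second identity is linear in the
    momentum. The first one rests on a rule for the Caputo derivative of a
    mean over the internal time: if f' = g on the half-line, then

      D^alpha (t |-> E f(S(t))) = (t |-> E g(S(t)))

    ([caputo_internal_mean]). Applied to x, whose derivative is p / m, it shows
    that the fractional momentum m D^alpha x_alpha is p_alpha; applied to p,
    whose derivative is - U'(x), it turns the fractional Euler-Lagrange equation
    into U'(x_alpha(t)) = E U'(x(S(t))), which is the claim.

    To prove the rule, let h(tau, s) be the density in s of the time at which S
    crosses the level tau ([hit]). For every t, two identities hold for almost
    every tau:

      int_0^t h(tau, s) ds = P(S(t) > tau)                    ([fracint_tail])
      int_0^t (t - s)^(-alpha) h(tau, s) ds / Gamma(1 - alpha)
        = dens t tau                                          ([fracint_dens])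

    The first one and Fubini give
    E f(S(t)) - f(0) = int g(tau) P(S(t) > tau) dtau
                     = int_0^t (int g(tau) h(tau, s) dtau) ds,
    so that, by Lebesgue differentiation, the derivative of the mean at almost
    every s is int g(tau) h(tau, s) dtau. Integrating it against
    (t - s)^(-alpha) and exchanging the integrals again, the second identity
    leaves E g(S(t)). All these integrals converge absolutely as soon as
    E |g(S(t))| is finite, because 1 <= t^alpha (t - s)^(-alpha) bounds the left
    side of the first identity by a multiple of the left side of the second.

    Both identities are equalities between functions of tau with the same
    moments. Those of S(t) are k! t^(alpha k) / Gamma(1 + alpha k): they are
    read off the Mittag-Leffler series, which is the Taylor series of the
    Laplace transform at 0 ([moments_of_laplace], [dens_moments]). Those of the
    left sides are Beta integrals ([fracint_moments]). Since Gamma grows faster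
    than any geometric sequence, the moments determine the Laplace transform,
    and hence the function up to a null set ([moments_determinate],
    [laplace_inj]). *)

Local Notation mu := lebesgue_measure.
Local Notation Rpos := `]0, +oo[%classic.
Local Notation measurableR := (measurable_fun (setT : set (measurableTypeR _))).

(** * Integration on the half-line *)

Lemma ae_imp (R : realType) (P Q : R -> Prop) :
  (forall x, P x -> Q x) -> {ae @lebesgue_measure R, forall x, P x} ->
  {ae @lebesgue_measure R, forall x, Q x}.
Proof. by move=> PQ; apply: filterS; first exact: (ae_filter_ringOfSetsType mu). Qed.

Lemma itv_oy_Rpos (R : realType) (a : R) : 0 <= a ->
  `]a, +oo[%classic = Rpos `&` `]a, +oo[%classic.
Proof.
move=> a0; apply/seteqP; split=> x/=; rewrite !in_itv/= !andbT; last by case.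
by move=> ax; split => //; exact: le_lt_trans ax.
Qed.

Lemma itv_0o_Rpos (R : realType) (a : R) :
  `]0, a[%classic = Rpos `&` `]-oo, a[%classic.
Proof.
by apply/seteqP; split=> x/=; rewrite !in_itv/= !andbT; [move=> /andP[]|case=> ->].
Qed.

Lemma measurable_powR_comp (R : realType) d (T : measurableType d) (f : T -> R) (r : R) :
  measurable_fun setT f -> measurable_fun setT (fun x => f x `^ r).
Proof. by move=> mf; apply: (measurableT_comp (measurable_powR r) mf). Qed.

Lemma measurable_expR_comp (R : realType) d (T : measurableType d) (f : T -> R) :
  measurable_fun setT f -> measurable_fun setT (fun x => expR (f x)).
Proof. by move=> mf; apply: measurableT_comp. Qed.

Ltac meas := repeat first
  [ assumption
  | exact: measurable_cst
  | exact: measurable_id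
  | exact: measurable_fst
  | exact: measurable_snd
  | apply: measurable_powR_comp
  | apply: measurable_expR_comp
  | apply: measurable_funN
  | apply: measurable_funM
  | apply: measurable_funB
  | apply: measurable_funD
  | apply: measurable_funX
  | apply/measurable_EFinP ].

Lemma integrable_ge0 (R : realType) (D : set (measurableTypeR R)) (g : R -> R) (c : R) :
  measurable D -> measurableR g ->
  (forall x, D x -> 0 <= g x) -> (\int[mu]_(x in D) (g x)%:E = c%:E)%E ->
  mu.-integrable D (fun x => (g x)%:E).
Proof.
move=> mD mg g0 gc; apply/integrableP; split; first by apply: measurable_funTS; meas.
suff -> : (\int[mu]_(x in D) `|(g x)%:E| = c%:E)%E by rewrite ltry.
by rewrite -gc; apply: eq_integral => x; rewrite inE => /g0 gx; rewrite gee0_abs.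
Qed.

Lemma integrable_bounded_mul (R : realType) (D : set (measurableTypeR R)) (g u : R -> R) :
  measurable D -> measurableR g -> measurableR u ->
  (forall x, D x -> `|g x| <= 1) ->
  mu.-integrable D (fun x => (u x)%:E) -> mu.-integrable D (fun x => (g x * u x)%:E).
Proof.
move=> mD mg mu_ g1 iu; apply: (le_integrable mD _ _ iu).
  by apply: measurable_funTS; meas.
by move=> x Dx; rewrite /= lee_fin normrM ler_piMl// g1.
Qed.

(** The integral of [w] may be infinite, so that the sign of [c] is split
    instead of appealing to integrability. *)
Lemma integralMl_ge0 (R : realType) (B : set (measurableTypeR R)) (c : R) (w : R -> R) :
  measurable B -> measurableR w -> (forall s, B s -> 0 <= w s) ->
  (\int[mu]_(s in B) (c * w s)%:E = c%:E * \int[mu]_(s in B) (w s)%:E)%E.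
Proof.
move=> mB mw w0.
have mw' : measurable_fun B (fun s => (w s)%:E) by apply: measurable_funTS; meas.
have w0' s : B s -> (0 <= (w s)%:E)%E by rewrite lee_fin; exact: w0.
have [c0|c0] := leP 0 c.
  rewrite -(ge0_integralZl mu mB mw' w0'); last by rewrite lee_fin.
  by apply: eq_integral => s _; rewrite EFinM.
have c0' : (0 <= (- c)%:E)%E by rewrite lee_fin oppr_ge0 ltW.
transitivity (- \int[mu]_(s in B) ((- c) * w s)%:E)%E.
  rewrite -integral_ge0N.
    by apply: eq_integral => s _; rewrite -EFinN; congr (_%:E); ring.
  by move=> s Bs; rewrite lee_fin mulr_ge0 ?oppr_ge0 ?(ltW c0)// w0.
rewrite (_ : (\int[mu]_(s in B) (- c * w s)%:E = (- c)%:E * \int[mu]_(s in B)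
    (w s)%:E)%E); last first.
  by rewrite -(ge0_integralZl mu mB mw' w0' c0'); apply: eq_integral => s _; rewrite EFinM.
by rewrite EFinN mulNe oppeK.
Qed.

Lemma tonelli_on (R : realType) (A B : set (measurableTypeR R))
    (f : R -> R -> \bar R) :
  measurable A -> measurable B ->
  measurable_fun (A `*` B) (fun z : measurableTypeR R * measurableTypeR R => f z.1 z.2) ->
  (forall x y, A x -> B y -> (0 <= f x y)%E) ->
  (\int[mu]_(x in A) \int[mu]_(y in B) f x y
   = \int[mu]_(y in B) \int[mu]_(x in A) f x y)%E.
Proof.
move=> mA mB mf f0.
set F := fun z : measurableTypeR R * measurableTypeR R => f z.1 z.2.
pose G := F \_ (A `*` B).
have mAB : measurable (A `*` B) by exact: measurableX.
have mG : measurable_fun setT G by apply/(measurable_restrictT _ mAB).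
have G0 z : (0 <= G z)%E.
  rewrite /G patchE; case: ifPn => //; rewrite inE => -[Az Bz]; exact: f0.
have GE x y : G (x, y) = if x \in A then if y \in B then f x y else 0%E else 0%E.
  by rewrite /G patchE in_setX/=; case: (x \in A); case: (y \in B).
have := @fubini_tonelli _ _ _ _ _ (@lebesgue_measure R) (@lebesgue_measure R) G mG G0.
rewrite [X in _ -> X = _](integral_mkcond A) [X in _ -> _ = X](integral_mkcond B).
move=> /= H; transitivity (\int[lebesgue_measure]_x \int[lebesgue_measure]_y G (x, y))%E.
  apply: eq_integral => x _; rewrite patchE; case: ifPn => xA.
    rewrite integral_mkcond; apply: eq_integral => y _.
    by rewrite GE xA patchE.
  rewrite integral0_eq// => y _; by rewrite GE (negbTE xA).
rewrite H; apply: eq_integral => y _; rewrite patchE; case: ifPn => yB.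
  rewrite [RHS]integral_mkcond; apply: eq_integral => x _.
  by rewrite GE patchE; case: ifPn => // xA; rewrite yB.
rewrite integral0_eq// => x _; by rewrite GE (negbTE yB); case: ifP.
Qed.

Lemma tonelli_triangle (R : realType) (f : R -> R -> \bar R) :
  measurable_fun setT (fun z : measurableTypeR R * measurableTypeR R => f z.1 z.2) ->
  (forall s r, 0 < s -> s < r -> (0 <= f s r)%E) ->
  (\int[mu]_(s in Rpos) \int[mu]_(r in `]s, +oo[) f s r
   = \int[mu]_(r in Rpos) \int[mu]_(s in `]0%R, r[) f s r)%E.
Proof.
move=> mf f0; pose g s r := if s < r then f s r else 0%E.
have mg : measurable_fun setT (fun z : measurableTypeR R * measurableTypeR R => g z.1 z.2).
  by apply: measurable_fun_ifT => //; apply: measurable_fun_ltr; meas.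
transitivity (\int[mu]_(s in Rpos) \int[mu]_(r in Rpos) g s r)%E.
  apply: eq_integral => s; rewrite inE/= in_itv/= andbT => s0.
  rewrite (itv_oy_Rpos (ltW s0)) integral_mkcondr; apply: eq_integral => r _.
  by rewrite patchE/= mem_setE in_itv/= andbT.
rewrite (tonelli_on (f := g)); [|exact: measurable_itv|exact: measurable_itv| |];
    last 2 first.
- exact: measurable_funTS.
- move=> s r; rewrite /= !in_itv/= !andbT /g => s0 _; case: ifPn => // sr; exact: f0.
apply: eq_integral => r; rewrite inE/= in_itv/= andbT => r0.
rewrite itv_0o_Rpos integral_mkcondr; apply: eq_integral => s _.
by rewrite patchE/= mem_setE in_itv/=.
Qed.

(** Fubini for a signed function of one variable against a nonnegative kernel.
    The inner integral [psi] is taken with real values, hence is meaningful for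
    almost every [s] only. *)
Lemma fubini_weight (R : realType) (A B : set (measurableTypeR R))
    (g : R -> R) (w : R -> R -> R) :
  measurable A -> measurable B ->
  measurableR g ->
  measurable_fun setT (fun z : measurableTypeR R * measurableTypeR R => w z.1 z.2) ->
  (forall x s, 0 <= w x s) ->
  (\int[mu]_(x in A) (`|g x|%:E * \int[mu]_(s in B) (w x s)%:E) < +oo)%E ->
  let psi s := \int[mu]_(x in A) (g x * w x s) in
  [/\ mu.-integrable B (fun s => (psi s)%:E),
      {ae @lebesgue_measure R, forall s, B s ->
        mu.-integrable A (fun x => (g x * w x s)%:E)}
    & (\int[mu]_(s in B) (psi s)%:E
       = \int[mu]_(x in A) ((g x)%:E * \int[mu]_(s in B) (w x s)%:E))%E].
Proof.
move=> mA mB mg mw w0 fin psi.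
have mws x : measurableR (w x) by exact: (measurable_fun_pair2 x mw).
have mwx s : measurableR (w^~ s) by exact: (measurable_fun_pair1 s mw).
pose f (z : measurableTypeR R * measurableTypeR R) : \bar R := (g z.2 * w z.2 z.1)%:E.
have mBA : measurable (B `*` A) by exact: measurableX.
have mf : measurable_fun setT f.
  apply/measurable_EFinP; apply: measurable_funM.
    by apply: (measurableT_comp mg); exact: measurable_snd.
  exact: (measurableT_comp mw (measurable_fun_pair measurable_snd measurable_fst)).
pose G := f \_ (B `*` A).
have mG : measurable_fun setT G.
  by apply/(measurable_restrictT _ mBA); exact: measurable_funTS.
have GE s x : G (s, x) = if x \in A then if s \in B then f (s, x) else 0%E else 0%E.
  by rewrite /G patchE in_setX/=; case: (x \in A); case: (s \in B).
have GA x : (\int[lebesgue_measure]_s G (s, x))%E =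
    if x \in A then ((g x)%:E * \int[mu]_(s in B) (w x s)%:E)%E else 0%E.
  case: ifPn => xA; last by rewrite integral0_eq// => s _; rewrite GE (negbTE xA).
  rewrite -(integralMl_ge0 _ mB (mws x) (fun s _ => w0 x s)).
  rewrite [RHS]integral_mkcond; apply: eq_integral => s _.
  by rewrite GE xA patchE.
have GB s : (\int[lebesgue_measure]_x G (s, x))%E =
    if s \in B then (\int[mu]_(x in A) (g x * w x s)%:E)%E else 0%E.
  case: ifPn => sB; last by rewrite integral0_eq// => x _; rewrite GE (negbTE sB);
      case: ifP.
  rewrite [RHS]integral_mkcond; apply: eq_integral => x _.
  by rewrite GE sB patchE.
have iG : ((@lebesgue_measure R) \x (@lebesgue_measure R))%E.-integrable setT G.
  apply/(integrable21ltyP _ _ mG); apply: le_lt_trans fin.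
  rewrite [leRHS]integral_mkcond le_eqVlt; apply/orP; left; apply/eqP;
      apply: eq_integral => x _.
  rewrite patchE; case: ifPn => xA; last first.
    by rewrite integral0_eq// => s _; rewrite GE (negbTE xA) abse0.
  rewrite -(integralMl_ge0 _ mB (mws x) (fun s _ => w0 x s)).
  rewrite [RHS]integral_mkcond; apply: eq_integral => s _.
  rewrite GE xA patchE; case: ifP => _; last by rewrite abse0.
  by rewrite /f/= normrM (ger0_norm (w0 _ _)).
have iF := integrable_fubini_F iG.
have aeI : {ae @lebesgue_measure R, forall s, B s ->
    mu.-integrable A (fun x => (g x * w x s)%:E)}.
  apply: ae_imp (ae_integrable1 iG) => s H Bs; apply/(integrable_mkcond _ mA).
  apply: eq_integrable H => //.
  by move=> x _; rewrite GE (mem_set Bs) patchE.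
have aeF : {ae @lebesgue_measure R, forall s, B s -> (psi s)%:E
    = (\int[lebesgue_measure]_x G (s, x))%E}.
  apply: ae_imp aeI => s H Bs; rewrite GB (mem_set Bs) /psi /Rintegral fineK//.
  exact: integrable_fin_num (H Bs).
have mFG : measurable_fun B (fun s => \int[lebesgue_measure]_x G (s, x))%E.
  by apply: measurable_funTS; exact: measurable_int iF.
have mpsi : measurable_fun B (fun s => (psi s)%:E).
  apply: (eq_measurable_fun (fun s => (fine (\int[lebesgue_measure]_x G (s, x)))%:E)).
    by move=> s sB; rewrite GB sB.
  by apply/measurable_EFinP; apply: measurableT_comp.
have iB : mu.-integrable B (fun s => \int[lebesgue_measure]_x G (s, x))%E.
  by apply: (integrableS _ _ _ iF).
split=> //.
  apply/integrableP; split=> //; have /integrableP[_] := iB; apply: le_lt_trans.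
  rewrite le_eqVlt; apply/orP; left; apply/eqP; apply: ae_eq_integral => //.
  - exact: measurableT_comp.
  - exact: measurableT_comp.
  - by apply: ae_imp aeF => s H Bs; rewrite H.
rewrite (ae_eq_integral _ _ mB mpsi mFG aeF).
transitivity (\int[lebesgue_measure]_s \int[lebesgue_measure]_x G (s, x))%E.
  rewrite integral_mkcond; apply: eq_integral => s _; rewrite patchE; case: ifPn => // sB.
  by rewrite GB (negbTE sB).
rewrite (Fubini iG) [RHS]integral_mkcond; apply: eq_integral => x _.
by rewrite GA patchE.
Qed.

(** Substitution for an integrand that is only measurable is an equality of two
    measures, which is checked on the intervals ]a, b]. *)
Lemma lebesgue_measure_shift (R : realType) (a : R) (A : set (measurableTypeR R)) :
  measurable A ->
  mu A = pushforward mu (fun x : measurableTypeR R => (x + a) : measurableTypeR R) A.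
Proof.
move=> mA; apply: lebesgue_measure_unique => //=.
  exact: measurable_funD.
move=> _ _ [[b c]] _ <-.
rewrite /pushforward (_ : _ @^-1` _ = `](b - a), (c - a)]%classic); last first.
  by apply/seteqP; split=> x/=; rewrite !in_itv/= ltrBlDr lerBrDr.
rewrite !lebesgue_measure_itv/= !lte_fin ltrD2r; case: ifP => // _.
by rewrite -!EFinD; congr (_%:E); ring.
Qed.

Lemma lebesgue_measure_scale (R : realType) (c : R) (A : set (measurableTypeR R)) :
  0 < c -> measurable A ->
  mu A = (c%:E * pushforward mu
    (fun x : measurableTypeR R => (c * x)%R : measurableTypeR R) A)%E.
Proof.
move=> c0 mA; pose c' := PosNum c0.
have mc : measurable_fun setT (fun x : measurableTypeR R => (c * x) : measurableTypeR R).
  exact: mulrl_measurable.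
apply: (@lebesgue_measure_unique _ (mscale (c'%:num%:nng) (pushforward mu
    (fun x : measurableTypeR R => (c * x) : measurableTypeR R)))) => //; last first.
move=> _ [[a b]] _ <-.
rewrite -[RHS]/(c%:E * mu ((fun x : R => c * x)%R @^-1` `]a, b]%classic))%E.
rewrite (_ : _ @^-1` _ = `](a / c), (b / c)]%classic); last first.
  by apply/seteqP; split=> x/=; rewrite !in_itv/= ltr_pdivrMr// ler_pdivlMr// ![x * _]mulrC.
rewrite !lebesgue_measure_itv/= !lte_fin ltr_pM2r ?invr_gt0//.
case: ifP => _; last by rewrite mule0.
by rewrite -!EFinD -EFinM; congr (_%:E); field; rewrite gt_eqF.
Qed.

Lemma ge0_integral_shift (R : realType) (a : R) (f : R -> \bar R) :
  measurable_fun (`]a, +oo[ : set (measurableTypeR R)) f ->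
  (forall x, a < x -> (0 <= f x)%E) ->
  (\int[mu]_(x in Rpos) f (x + a)%R = \int[mu]_(x in `]a, +oo[) f x)%E.
Proof.
move=> mf f0.
have ms : measurable_fun setT (fun x : measurableTypeR R => (x + a) : measurableTypeR R).
  exact: measurable_funD.
rewrite [RHS](eq_measure_integral (pushforward mu
    (fun x : measurableTypeR R => (x + a) : measurableTypeR R))) => //; last first.
  by move=> A mA _; exact: lebesgue_measure_shift.
rewrite ge0_integral_pushforward//=; last first.
  by move=> x; rewrite inE/= in_itv/= andbT => /f0.
congr (integral _ _ _); apply/seteqP; split=> x/=; rewrite !in_itv/= !andbT.
  by rewrite ltrDr.
by rewrite ltrDr.
Qed.

Lemma ge0_integral_scale (R : realType) (c : R) (f : R -> \bar R) : 0 < c ->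
  measurable_fun (Rpos : set (measurableTypeR R)) f ->
  (forall x, 0 < x -> (0 <= f x)%E) ->
  (c%:E * \int[mu]_(x in Rpos) f (c * x)%R = \int[mu]_(x in Rpos) f x)%E.
Proof.
move=> c0 mf f0; pose c' := PosNum c0.
have mc : measurable_fun setT (fun x : measurableTypeR R => (c * x) : measurableTypeR R).
  exact: mulrl_measurable.
rewrite [RHS](eq_measure_integral (mscale (c'%:num%:nng) (pushforward mu
    (fun x : measurableTypeR R => (c * x) : measurableTypeR R)))) => //; last first.
  by move=> A mA _; exact: lebesgue_measure_scale.
rewrite ge0_integral_mscale//=; last first.
  by move=> x; rewrite /= in_itv/= andbT => /f0.
congr (_ * _)%E; rewrite ge0_integral_pushforward//=; last first.
  by move=> x; rewrite inE/= in_itv/= andbT => /f0.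
congr (integral _ _ _); apply/seteqP; split=> x/=; rewrite !in_itv/= !andbT.
  by rewrite pmulr_rgt0.
by rewrite pmulr_rgt0.
Qed.
(** * Euler's integrals *)

Lemma powRDp (R : realType) (x r s : R) : 0 < x -> x `^ (r + s) = x `^ r * x `^ s.
Proof. by move=> x0; apply: powRD; rewrite (gt_eqF x0) implybT. Qed.

Lemma integral_powR_cc (R : realType) (a t z : R) : 0 < a -> a < t -> 0 < z ->
  (\int[mu]_(s in `[a, t]) (s `^ (z - 1))%:E = (z^-1 * (t `^ z - a `^ z))%:E)%E.
Proof.
move=> a0 at0 z0; have t0 := lt_trans a0 at0.
have der (x : R) : 0 < x -> is_derive x 1 (fun x => z^-1 * x `^ z) (x `^ (z - 1)).
  move=> x0; have H := is_derive1_powR z x0.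
  have := is_deriveZ z^-1 H.
  by rewrite scalerA mulVf ?scale1r// gt_eqF.
have cF (x : R) : 0 < x -> {for x, continuous (fun x => z^-1 * x `^ z)}.
  by move=> x0; apply: differentiable_continuous; apply/derivable1_diffP;
      have [] := der _ x0.
rewrite (@continuous_FTC2 _ (fun s => s `^ (z - 1)) (fun x => z^-1 * x `^ z))//.
- by rewrite -EFinB mulrBr.
- apply: continuous_in_subspaceT => x; rewrite inE/= in_itv/= => /andP[ax _].
  apply: differentiable_continuous; apply/derivable1_diffP.
  by have [] := is_derive1_powR (z - 1) (lt_le_trans a0 ax).
- split.
  + by move=> x; rewrite in_itv/= => /andP[ax _]; have [] := der _ (lt_trans a0 ax).
  + exact/cvg_at_right_filter/cF.
  + exact/cvg_at_left_filter/cF.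
- move=> x; rewrite in_itv/= => /andP[ax _].
  have H := der _ (lt_trans a0 ax).
  by rewrite derive1E; apply: derive_val.
Qed.

(** For z < 1 the integrand is unbounded at 0: the integrals over
    [t / (n + 2), t] are passed to the limit. *)
Lemma integral_powR_oc (R : realType) (t z : R) : 0 < t -> 0 < z ->
  (\int[mu]_(s in `]0%R, t]) (s `^ (z - 1))%:E = (z^-1 * t `^ z)%:E)%E.
Proof.
move=> t0 z0.
pose F (n : nat) := `[t / n.+2%:R, t]%classic.
have UF : \bigcup_i F i = `]0, t]%classic.
  apply/seteqP; split => x/=.
    by move=> [i _]; rewrite /F/= !in_itv/= => /andP[+ ->]; rewrite andbT;
        apply: lt_le_trans; rewrite divr_gt0.
  rewrite in_itv/= => /andP[x0 xt].
  exists (Num.truncn (t / x)) => //; rewrite /F/= in_itv/= xt andbT.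
  rewrite ler_pdivrMr// mulrC -ler_pdivrMr//.
  apply/ltW/(lt_le_trans (truncnS_gt _)); by rewrite ler_nat.
have mp : measurable_fun setT (fun s : R => (s `^ (z - 1))%:E).
  by apply/measurable_EFinP; exact: measurable_powR.
have H := @ge0_nondecreasing_set_cvg_integral _ (measurableTypeR R) R F (fun s : R =>
    (s `^ (z - 1))%:E) (@lebesgue_measure R).
rewrite UF in H; apply/esym; apply/(cvg_unique _ _ (H _ _ _ _)) => //.
- rewrite (_ : (fun i => _) = (fun i => (z^-1 * (t `^ z - (t / i.+2%:R) `^ z))%:E));
      last first.
    apply/funext => i; rewrite integral_powR_cc// ?divr_gt0//.
    by rewrite ltr_pdivrMr// ltr_pMr// ltr1n.
  apply: cvg_EFin; first exact: nearW.
  rewrite [X in _ --> X](_ : _ = z^-1 * (t `^ z - 0)); last by rewrite subr0.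
  apply: cvgMr; apply: cvgB; first exact: cvg_cst.
  apply: (@cvg_comp _ _ _ (fun n : nat => t / n.+2%:R) (fun a => a `^ z) _ (0:R)^'+);
      last exact: powR_cvg0.
  move=> A [e /= e0 eA]; exists (Num.truncn (t / e)) => // n /= en.
  have n0 : 0 < t / n.+2%:R by rewrite divr_gt0.
  apply: eA => //=; rewrite sub0r normrN gtr0_norm// ltr_pdivrMr// mulrC -ltr_pdivrMr//.
  by rewrite (lt_le_trans (truncnS_gt _))// ler_nat ltnS (leq_trans en).
- move=> n m nm; rewrite /F; apply/subsetPset/subset_itvr; rewrite bnd_simp.
  by rewrite ler_pM2l// lef_pV2 ?posrE// ler_nat.
- by move=> i; exact: measurable_itv.
- by move=> i; exact: measurable_funTS.
- by move=> i x _; rewrite lee_fin powR_ge0.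
Qed.

(** Euler's integrals are first taken with extended real values, so that their
    finiteness can be deduced from identities between them. *)
Definition EGamma (R : realType) (z : R) : \bar R :=
  (\int[mu]_(s in Rpos) (s `^ (z - 1) * expR (- s))%:E)%E.

Definition EBeta (R : realType) (a b : R) : \bar R :=
  (\int[mu]_(s in `]0%R, 1%R[) (s `^ (a - 1) * (1 - s) `^ (b - 1))%:E)%E.

Lemma EGamma_ge0 (R : realType) (z : R) : (0 <= EGamma z)%E.
Proof. by apply: integral_ge0 => s _; rewrite lee_fin mulr_ge0 ?powR_ge0 ?expR_ge0. Qed.

Lemma EBeta_ge0 (R : realType) (a b : R) : (0 <= EBeta a b)%E.
Proof. by apply: integral_ge0 => s _; rewrite lee_fin mulr_ge0 ?powR_ge0. Qed.

Lemma beta_scale (R : realType) (a b r : R) : 0 < r ->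
  (\int[mu]_(s in `]0%R, r[) (s `^ (a - 1) * (r - s) `^ (b - 1))%:E
   = (r `^ (a + b - 1))%:E * EBeta a b)%E.
Proof.
move=> r0.
pose f (s : R) : \bar R := if s < r then (s `^ (a - 1) * (r - s) `^ (b - 1))%:E else 0%E.
have mf : measurableR f.
  apply: measurable_fun_ifT; [by apply: measurable_fun_ltr; meas| by meas|by meas].
have f0 x : (0 <= f x)%E.
  by rewrite /f; case: ifP => // _; rewrite lee_fin mulr_ge0 ?powR_ge0.
transitivity (\int[mu]_(s in Rpos) f s)%E.
  rewrite itv_0o_Rpos integral_mkcondr; apply: eq_integral => s _.
  by rewrite patchE/= mem_setE in_itv/=.
rewrite -(ge0_integral_scale r0)//; last exact: measurable_funTS.
transitivity (r%:E * ((r `^ (a + b - 1 - 1))%:E * EBeta a b))%E; last first.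
  rewrite muleA -EFinM -{1}(powRr1 (ltW r0)) -powRDp//.
  by congr ((r `^ _)%:E * _)%E; ring.
congr (_ * _)%E; rewrite /EBeta itv_0o_Rpos integral_mkcondr -ge0_integralZl//;
    last 3 first.
- apply/(measurable_restrict _ (measurable_itv _)) => //; apply: measurable_funTS; meas.
- move=> x _; rewrite patchE; case: ifP => // _; rewrite lee_fin mulr_ge0 ?powR_ge0//.
- by rewrite lee_fin powR_ge0.
apply: eq_integral => x; rewrite inE/= in_itv/= andbT => x0.
rewrite patchE mem_setE in_itv/= /f -{2}(mulr1 r) ltr_pM2l//; case: ifPn => x1;
    last by rewrite mule0.
rewrite -EFinM; congr (_%:E).
rewrite -{2}(mulr1 r) -mulrBr !powRM// ?(ltW r0) ?(ltW x0) ?subr_ge0 ?(ltW x1)//.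
rewrite (_ : a + b - 1 - 1 = (a - 1) + (b - 1)); last by ring.
rewrite [r `^ (a - 1 + (b - 1))]powRDp//.
ring.
Qed.

(** The double integral of s^(a-1) u^(b-1) exp(-(s+u)) is computed along the
    lines s + u = r. *)
Lemma EGammaM (R : realType) (a b : R) :
  (EGamma a * EGamma b = EBeta a b * EGamma (a + b))%E.
Proof.
have mG (z : R) : measurableR (fun s : R => (s `^ (z - 1) * expR (- s))%:E) by meas.
have G0 z (s : R) : (0 <= (s `^ (z - 1) * expR (- s))%:E)%E.
  by rewrite lee_fin mulr_ge0 ?powR_ge0 ?expR_ge0.
rewrite {1}/EGamma -(ge0_integralZr mu (measurable_itv _) (measurable_funTS (mG a))
    (fun s _ => G0 a s) (EGamma_ge0 b)).
pose f (s r : R) : \bar R := (s `^ (a - 1) * ((r - s) `^ (b - 1) * expR (- r)))%:E.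
have mf : measurable_fun setT (fun z : measurableTypeR R * measurableTypeR R => f z.1 z.2).
  by rewrite /f; meas.
have f0 s r : (0 <= f s r)%E by rewrite lee_fin !mulr_ge0 ?powR_ge0 ?expR_ge0.
have mfs s : measurableR (f s) by rewrite /f; meas.
transitivity (\int[mu]_(s in Rpos) \int[mu]_(r in `]s, +oo[) f s r)%E.
  apply: eq_integral => s _.
  rewrite -(ge0_integralZl mu (measurable_itv _) (measurable_funTS (mG b)) (fun s _ =>
      G0 b s) (G0 a s)).
  rewrite -(ge0_integral_shift (measurable_funTS (mfs s)) (fun r _ => f0 s r)).
  apply: eq_integral => u _; rewrite -EFinM; congr (_%:E).
  rewrite addrK opprD expRD; ring.
rewrite (tonelli_triangle mf (fun s r _ _ => f0 s r)).
rewrite /EGamma -(ge0_integralZl mu (measurable_itv _) (measurable_funTS (mG _))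
    (fun s _ => G0 _ s) (EBeta_ge0 a b)).
apply: eq_integral => r; rewrite inE/= in_itv/= andbT => r0.
rewrite (_ : _%:E = (expR (- r))%:E * (r `^ (a + b - 1))%:E)%E;
    last by rewrite -EFinM mulrC.
rewrite muleCA (muleC (EBeta _ _)) -(beta_scale a b r0).
have mh : measurableR (fun s : R => (s `^ (a - 1) * (r - s) `^ (b - 1))%:E) by meas.
rewrite -(ge0_integralZl mu (measurable_itv _) (measurable_funTS mh)); last 2 first.
- by move=> x _; rewrite lee_fin !mulr_ge0 ?powR_ge0.
- by rewrite lee_fin expR_ge0.
by apply: eq_integral => s _; rewrite -EFinM; congr (_%:E); ring.
Qed.

Lemma EGamma1 (R : realType) : EGamma (1 : R) = 1%E.
Proof.
rewrite -(integral_exponential_pdf (ltr01 : 0 < 1 :> R)) /EGamma.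
transitivity (\int[mu]_(s in `[0%R, +oo[) (expR (- s))%:E : \bar R)%E.
  rewrite -integral_itv_obnd_cbnd; last by apply: measurable_funTS; meas.
  by apply: eq_integral => s _; rewrite subrr powRr0 mul1r.
rewrite integral_mkcond; apply: eq_integral => s _.
by rewrite /exponential_pdf !patchE; case: ifP => // _; rewrite mul1r mulN1r.
Qed.

Lemma EBeta1 (R : realType) (z : R) : 0 < z -> EBeta z 1 = (z^-1)%:E.
Proof.
move=> z0; transitivity (\int[mu]_(s in `]0%R, 1%R]) (s `^ (z - 1))%:E)%E.
  rewrite -integral_itv_bndo_bndc; last by apply: measurable_funTS; meas.
  by apply: eq_integral => s _; rewrite subrr powRr0 mulr1.
by rewrite integral_powR_oc// powR1 mulr1.
Qed.

Lemma EGammaD1 (R : realType) (z : R) : 0 < z -> EGamma (z + 1) = (z%:E * EGamma z)%E.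
Proof.
move=> z0; have := EGammaM z 1; rewrite EGamma1 mule1 (EBeta1 z0) => ->.
by rewrite muleA -EFinM mulfV ?mul1e// gt_eqF.
Qed.

(** For z <= 1 the integrand is below s^(z-1) on ]0, 1] and below exp(-s)
    beyond; the functional equation covers the other values of z. *)
Lemma EGamma_lty (R : realType) (z : R) : 0 < z -> (EGamma z < +oo)%E.
Proof.
move=> z0.
have small (y : R) : 0 < y -> y <= 1 -> (EGamma y < +oo)%E.
  move=> y0 y1.
  have mG : measurableR (fun s : R => (s `^ (y - 1) * expR (- s))%:E) by meas.
  have mP : measurableR (fun s : R => (s `^ (y - 1))%:E) by meas.
  have mE : measurableR (fun s : R => (s `^ (1 - 1) * expR (- s))%:E) by meas.
  rewrite /EGamma (_ : Rpos = `]0, 1] `|` `]1, +oo[)%classic; last first.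
    by rewrite -itv_bndbnd_setU// bnd_simp.
  rewrite ge0_integral_setU; [|exact: measurable_itv|exact: measurable_itv|exact:
      measurable_funTS| |]; last 2 first.
  - by move=> s _; rewrite lee_fin mulr_ge0 ?powR_ge0 ?expR_ge0.
  - apply/disj_setPS => x [/=]; rewrite !in_itv/= => /andP[_ x1]; rewrite andbT.
    by rewrite ltNge x1.
  apply: lte_add_pinfty.
    apply: le_lt_trans (ltry (y^-1 * 1 `^ y)).
    rewrite -(integral_powR_oc ltr01 y0).
    apply: ge0_le_integral; [exact: measurable_itv| |exact: measurable_funTS|exact:
        measurable_funTS|].
    - by move=> s _; rewrite lee_fin mulr_ge0 ?powR_ge0 ?expR_ge0.
    - move=> s; rewrite /= in_itv/= => /andP[s0 _]; rewrite lee_fin ler_piMr ?powR_ge0//.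
      by rewrite -expR0 ler_expR oppr_le0 ltW.
  apply: le_lt_trans (ltry 1); rewrite -(EGamma1 R).
  apply: (@le_trans _ _ (\int[mu]_(s in `]1%R, +oo[) (s `^ (1 - 1) * expR (- s))%:E)%E).
    apply: ge0_le_integral; [exact: measurable_itv| |exact: measurable_funTS|exact:
        measurable_funTS|].
    - by move=> s _; rewrite lee_fin mulr_ge0 ?powR_ge0 ?expR_ge0.
    - move=> s; rewrite /= in_itv/= andbT => s1; rewrite lee_fin ler_wpM2r ?expR_ge0//.
      by rewrite ler_powR ?(ltW s1)// lerB.
  apply: ge0_subset_integral; [exact: measurable_itv|exact: measurable_itv|exact:
      measurable_funTS| |].
  - by move=> s _; rewrite lee_fin mulr_ge0 ?powR_ge0 ?expR_ge0.
  - by apply: subset_itvr; rewrite bnd_simp.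
suff H n : forall y : R, 0 < y -> y <= 1 + n%:R -> (EGamma y < +oo)%E.
  by apply: (H (Num.truncn z).+1) => //; rewrite (le_trans (ltW (truncnS_gt _)))// lerDr.
elim: n => [y y0|n IH y y0 yn]; first by rewrite addr0; exact: small.
have [y1|y1] := leP y 1; first exact: small.
have y10 : 0 < y - 1 by rewrite subr_gt0.
rewrite (_ : y = (y - 1) + 1); last by ring.
rewrite EGammaD1// lte_mul_pinfty//; first by rewrite lee_fin ltW.
by apply: IH => //; move: yn; rewrite -natr1; lra.
Qed.

Lemma GammaE (R : realType) (z : R) : 0 < z -> (Gamma z)%:E = EGamma z.
Proof.
move=> z0; rewrite /Gamma/Rintegral -/(EGamma z) fineK//.
by rewrite ge0_fin_numE ?EGamma_ge0// EGamma_lty.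
Qed.

Lemma GammaD1 (R : realType) (z : R) : 0 < z -> Gamma (z + 1) = z * Gamma z.
Proof.
by move=> z0; apply: EFin_inj; rewrite EFinM !GammaE ?addr_gt0// EGammaD1.
Qed.

(** The part of the integral beyond [A] suffices. As [A] is arbitrary, Gamma
    outgrows every geometric sequence. *)
Lemma Gamma_ge (R : realType) (A z : R) : 0 < A -> 1 <= z ->
  A `^ (z - 1) * expR (- A) <= Gamma z.
Proof.
move=> A0 z1; rewrite -lee_fin GammaE ?(lt_le_trans _ z1)//.
have mG (y : R) : measurableR (fun s : R => (s `^ (y - 1) * expR (- s))%:E) by meas.
have G0 y (s : R) : (0 <= (s `^ (y - 1) * expR (- s))%:E)%E.
  by rewrite lee_fin mulr_ge0 ?powR_ge0 ?expR_ge0.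
have G10 (s : R) : (0 <= (expR (- s))%:E)%E by rewrite lee_fin expR_ge0.
have mE : measurableR (fun s : R => (expR (- s))%:E) by meas.
have eA : (\int[mu]_(s in `]A, +oo[) (expR (- s))%:E = (expR (- A))%:E)%E.
  rewrite -(ge0_integral_shift (measurable_funTS mE))//.
  rewrite -[RHS]mule1 -(EGamma1 R) /EGamma -(ge0_integralZl mu (measurable_itv _)
      (measurable_funTS (mG _)) (fun s _ => G0 _ s) (G10 _)).
  by apply: eq_integral => s _; rewrite subrr powRr0 mul1r -EFinM opprD expRD mulrC.
rewrite EFinM -eA -(ge0_integralZl mu (measurable_itv _) (measurable_funTS mE)
    (fun s _ => G10 s)); last first.
  by rewrite lee_fin powR_ge0.
have mAE : measurableR (fun s : R => ((A `^ (z - 1))%:E * (expR (- s))%:E)%E) by meas.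
apply: (@le_trans _ _ (\int[mu]_(s in `]A, +oo[) (s `^ (z - 1) * expR (- s))%:E)%E).
  apply: ge0_le_integral; [exact: measurable_itv| |exact: measurable_funTS|exact:
      measurable_funTS|].
  - by move=> s _; rewrite -EFinM lee_fin mulr_ge0 ?powR_ge0 ?expR_ge0.
  - move=> s; rewrite /= in_itv/= andbT => s1; rewrite lee_fin ler_wpM2r ?expR_ge0//.
    apply: ge0_ler_powR; rewrite ?subr_ge0 ?nnegrE ?(ltW s1) ?(ltW A0)//.
    by rewrite ltW// (lt_trans A0).
apply: ge0_subset_integral; [exact: measurable_itv|exact: measurable_itv|exact:
    measurable_funTS| |].
- by move=> s _.
- by apply: subset_itvr; rewrite bnd_simp ltW.
Qed.

Lemma Gamma_gt0 (R : realType) (z : R) : 0 < z -> 0 < Gamma z.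
Proof.
move=> z0; rewrite -(pmulr_rgt0 _ z0) -GammaD1//.
apply: (lt_le_trans _ (@Gamma_ge _ 1 _ ltr01 _)); last by rewrite lerDr ltW.
by rewrite mulr_gt0 ?powR_gt0 ?expR_gt0.
Qed.

Lemma beta_integral (R : realType) (a b r : R) : 0 < a -> 0 < b -> 0 < r ->
  (\int[mu]_(s in `]0%R, r[) (s `^ (a - 1) * (r - s) `^ (b - 1))%:E
   = (r `^ (a + b - 1) * (Gamma a * Gamma b / Gamma (a + b)))%:E)%E.
Proof.
move=> a0 b0 r0; rewrite beta_scale// EFinM; congr (_ * _)%E.
have ab0 := addr_gt0 a0 b0; have g0 := Gamma_gt0 ab0.
have := EGammaM a b; rewrite -!GammaE// -EFinM => E.
by rewrite EFinM E -muleA -EFinM divff ?mule1// gt_eqF.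
Qed.

(** * Taylor remainders of the exponential *)

(** (-1)^k times the difference between exp(-x) and its Taylor polynomial of
    degree < k. With this sign the remainders are nonnegative, and consecutive
    ones add up to a monomial, which is what passes under integrals. *)
Fixpoint expNrem (R : realType) (k : nat) (x : R) : R :=
  if k is k'.+1 then x ^+ k' / k'`!%:R - expNrem k' x else expR (- x).

Lemma is_derive_expNremS (R : realType) (k : nat) (x : R) :
  is_derive x 1 (expNrem k.+1) (expNrem k x).
Proof.
elim: k => [|k IH].
  have H := is_deriveB (is_derive_cst (1 : R) x 1)
    (is_derive1_comp (is_derive_expR (- x)) (is_deriveN (is_derive_id x 1))).
  rewrite /= (_ : (fun y => _) = (cst 1 - (expR \o -%R))); last first.
    by apply/funext => y; rewrite fact0 expr0 divr1.
  by apply: (is_derive_eq H); rewrite mulrN1 sub0r opprK.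
have H := is_deriveB (is_deriveZ (k.+1`!%:R)^-1 (is_deriveX k.+1 (is_derive_id x 1))) IH.
rewrite (_ : expNrem k.+2 = ((k.+1`!%:R)^-1 \*: (id ^+ k.+1) - expNrem k.+1)); last first.
  apply/funext => y; rewrite [LHS]/= -/(expNrem k.+1 y) mulrC.
  have -> : y ^+ k.+1 = (@id R ^+ k.+1) y by rewrite exprfctE.
  by [].
apply: (is_derive_eq H); rewrite /= /GRing.scale/= mulr1.
have k0 : k.+1%:R != 0 :> R by rewrite pnatr_eq0.
have f0 : k`!%:R != 0 :> R by rewrite pnatr_eq0 -lt0n fact_gt0.
rewrite factS natrM; congr (_ - _); field.
by rewrite -nat1r in k0; rewrite k0 f0.
Qed.

Lemma expNrem0 (R : realType) (k : nat) : expNrem k.+1 (0 : R) = 0.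
Proof.
elim: k => [|k IH]; first by rewrite /= oppr0 expR0 fact0 expr0 divr1 subrr.
by rewrite [LHS]/= -/(expNrem k.+1 0) IH expr0n/= mul0r subrr.
Qed.

(** Each remainder of positive order vanishes at 0 and has the previous one as
    its derivative. *)
Lemma expNrem_ge0 (R : realType) (k : nat) (x : R) : 0 <= x -> 0 <= expNrem k x.
Proof.
move=> x0; case: k => [|k]; first exact: expR_ge0.
elim: k x x0 => [|k IH] x x0.
  by rewrite /= fact0 expr0 divr1 subr_ge0 -expR0 ler_expR oppr_le0.
rewrite -(expNrem0 R k.+1).
apply: (@ger0_derive1_ndecry _ (expNrem k.+2) 0) => //.
- by move=> y _; have [] := is_derive_expNremS k.+1 y.
- move=> y; rewrite in_itv/= andbT => y0; rewrite derive1E.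
  have H := is_derive_expNremS k.+1 y.
  by rewrite derive_val IH// ltW.
- apply: continuous_subspaceT => y.
  apply: differentiable_continuous; apply/derivable1_diffP.
  by have [] := is_derive_expNremS k.+1 y.
Qed.

(** Two consecutive nonnegative remainders add up to the right-hand side. *)
Lemma expNrem_le (R : realType) (k : nat) (x : R) : 0 <= x ->
  expNrem k x <= x ^+ k / k`!%:R.
Proof. by move=> x0; rewrite -subr_ge0; exact: (@expNrem_ge0 _ k.+1). Qed.

Lemma expNrem_scaled (R : realType) (k : nat) (v x : R) : 0 < v -> 0 <= x ->
  `|x ^+ k / k`!%:R - v ^- k * expNrem k (v * x)| <= v * (x ^+ k.+1 / k.+1`!%:R).
Proof.
move=> v0 x0; have vx0 : 0 <= v * x by rewrite mulr_ge0// ltW.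
have vk0 : 0 < v ^+ k by rewrite exprn_gt0.
have -> : x ^+ k / k`!%:R - v ^- k * expNrem k (v * x) = v ^- k * expNrem k.+1 (v * x).
  by rewrite /= mulrBr exprMn mulrA mulrA mulVf ?mul1r// gt_eqF.
rewrite ger0_norm ?mulr_ge0 ?invr_ge0 ?(ltW vk0) ?expNrem_ge0//.
rewrite mulrC ler_pdivrMr//; apply: le_trans (expNrem_le _ vx0) _.
by rewrite exprMn exprS le_eqVlt; apply/orP; left; apply/eqP; ring.
Qed.

Lemma measurable_expNrem (R : realType) (k : nat) :
  measurableR (@expNrem R k).
Proof. by elim: k => [|k IH] /=; meas. Qed.

(** * Moments and Laplace transforms *)

Definition has_moments (R : realType) (f : R -> R) (m : nat -> R) : Prop :=
  [/\ measurableR f, forall x, 0 <= f x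
    & forall k, (\int[mu]_(x in Rpos) (x ^+ k * f x)%:E = (m k)%:E)%E].

Lemma integral_expNremS (R : realType) (f : R -> R) (k : nat) (v M I : R) :
  measurableR f -> (forall x, 0 <= f x) -> 0 <= v ->
  (\int[mu]_(x in Rpos) (x ^+ k * f x)%:E = M%:E)%E ->
  (\int[mu]_(x in Rpos) (expNrem k (v * x) * f x)%:E = I%:E)%E ->
  (\int[mu]_(x in Rpos) (expNrem k.+1 (v * x) * f x)%:E
    = (v ^+ k * M / k`!%:R - I)%:E)%E.
Proof.
move=> mf f0 v0 HM HI.
have mr j : measurableR (fun x : R => expNrem j (v * x)).
  by apply: (measurableT_comp (measurable_expNrem j)); exact: mulrl_measurable.
have mrk := mr k.
have iM : mu.-integrable Rpos (fun x => (x ^+ k * f x)%:E).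
  apply: (integrable_ge0 (measurable_itv _) _ _ HM); first by meas.
  by move=> x; rewrite /= in_itv/= andbT => x0; rewrite mulr_ge0// exprn_ge0// ltW.
have iI : mu.-integrable Rpos (fun x => (expNrem k (v * x) * f x)%:E).
  apply: (integrable_ge0 (measurable_itv _) _ _ HI); first by meas.
  by move=> x; rewrite /= in_itv/= andbT => x0;
      rewrite mulr_ge0// expNrem_ge0// mulr_ge0// ltW.
transitivity (\int[mu]_(x in Rpos) ((v ^+ k / k`!%:R)%:E * (x ^+ k * f x)%:E -
    (expNrem k (v * x) * f x)%:E))%E.
  apply: eq_integral => x _; rewrite -EFinM -EFinB; congr (_%:E).
  by rewrite /= exprMn; ring.
rewrite integralB; [|exact: measurable_itv|by apply: integrableZl;
    first exact: measurable_itv|exact: iI].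
rewrite integralZl; [|exact: measurable_itv|exact: iM]; rewrite HM HI -EFinM -EFinB;
    congr (_%:E); ring.
Qed.

(** The moments are the Taylor coefficients of the Laplace transform at 0. Here
    [E k v] is the tail sum over j of (-v)^j a_(j+k). Knowing the moments below
    k, the integral of R_k(v x) f(x) is v^k E k v, where R_k is the Taylor
    remainder. Divided by v^k, the integrand stays below x^k f(x) / k! and tends
    to it as v tends to 0: the first fact bounds the k-th moment from below, and
    Fatou's lemma bounds it from above. *)
Lemma moments_of_laplace (R : realType) (f : R -> R) (a : nat -> R)
    (E : nat -> R -> R) (C : R) :
  measurableR f -> (forall x, 0 <= f x) ->
  (forall k v, 0 < v -> v <= 1 -> E k v = a k - v * E k.+1 v) ->
  (forall k v, 0 < v -> v <= 1 -> `|E k v| <= C) ->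
  (forall v, 0 < v -> v <= 1 ->
    (\int[mu]_(x in Rpos) (expR (- (v * x)) * f x)%:E = (E 0 v)%:E)%E) ->
  has_moments f (fun k => k`!%:R * a k).
Proof.
move=> mf f0 Erec EC H0; split=> //.
have mr j v : measurableR (fun x : R => expNrem j (v * x)).
  by apply: (measurableT_comp (measurable_expNrem j)); exact: mulrl_measurable.
have C0 : 0 <= C by apply: le_trans (EC 0%N 1 ltr01 (lexx _)).
have mom k : (forall v, 0 < v -> v <= 1 ->
    (\int[mu]_(x in Rpos) (expNrem k (v * x) * f x)%:E = (v ^+ k * E k v)%:E)%E) ->
    (\int[mu]_(x in Rpos) (x ^+ k * f x)%:E = (k`!%:R * a k)%:E)%E.
  move=> Hk.
  have fk0 : 0 < k`!%:R :> R by rewrite ltr0n fact_gt0.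
  pose u (n : nat) : R := n.+1%:R^-1.
  have u0 n : 0 < u n by rewrite invr_gt0.
  have u1 n : u n <= 1 by rewrite invf_le1// ler1n.
  have ucvg : u @ \oo --> (0 : R) by exact: cvg_harmonic.
  have mru n := mr k (u n).
  have Ecvg : (fun n => E k (u n)) @ \oo --> a k.
    apply/cvgrPdist_le => e e0.
    have : u n * C @[n --> \oo] --> 0 * C by apply: cvgMl.
    rewrite mul0r => /cvgrPdist_le/(_ _ e0); apply: filterS => n.
    rewrite sub0r normrN (ger0_norm (mulr_ge0 (ltW (u0 n)) C0)); apply: le_trans.
    rewrite Erec// opprB addrC subrK normrM (gtr0_norm (u0 n)) ler_wpM2l ?(ltW (u0 n))//.
    exact: EC.
  have I n : (\int[mu]_(x in Rpos) ((u n) ^- k * (expNrem k (u n * x) * f x))%:E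
      = (E k (u n))%:E)%E.
    under eq_integral do rewrite EFinM.
    have mrn := mru n; rewrite ge0_integralZl; [|exact: measurable_itv| | |].
    - rewrite Hk// -EFinM mulrA mulVf ?mul1r// gt_eqF// exprn_gt0//.
    - by apply: measurable_funTS; meas.
    - move=> x; rewrite /= in_itv/= andbT => x0; rewrite lee_fin mulr_ge0// expNrem_ge0//.
      by rewrite mulr_ge0// ltW.
    - by rewrite lee_fin invr_ge0 exprn_ge0// ltW.
  have mI n : measurableR (fun x : R => ((u n) ^- k * (expNrem k (u n * x) * f x))%:E).
    by have mrn := mru n; meas.
  have mxkf : measurableR (fun x : R => (x ^+ k / k`!%:R * f x)%:E) by meas.
  have -> : (\int[mu]_(x in Rpos) (x ^+ k * f x)%:E = k`!%:R%:E * \int[mu]_(x in Rpos)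
      (x ^+ k / k`!%:R * f x)%:E)%E.
    rewrite -ge0_integralZl; [|exact: measurable_itv| | |by rewrite lee_fin ltW].
    - apply: eq_integral => x _; rewrite -EFinM; congr (_%:E); field.
      by rewrite gt_eqF.
    - exact: measurable_funTS.
    - move=> x; rewrite /= in_itv/= andbT => x0; rewrite lee_fin mulr_ge0// divr_ge0//.
      by rewrite exprn_ge0// ltW.
  rewrite EFinM; congr (_ * _)%E; apply/eqP; rewrite eq_le; apply/andP; split.
    have pt x : 0 < x -> limn_einf (fun n => ((u n) ^- k * (expNrem k (u n * x) * f x))%:E)
        = (x ^+ k / k`!%:R * f x)%:E.
      move=> x0; apply: (cvg_limn_einf_sup _).1.
      apply: cvg_EFin; first exact: nearW.
      apply/cvgrPdist_le => e e0.
      have : u n * (x ^+ k.+1 / k.+1`!%:R * f x) @[n --> \oo] -->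
          0 * (x ^+ k.+1 / k.+1`!%:R * f x).
        exact: cvgMl.
      rewrite mul0r => /cvgrPdist_le/(_ _ e0); apply: filterS => n.
      rewrite sub0r normrN => un.
      rewrite [X in _ - X]mulrA -mulrBl normrM (ger0_norm (f0 x)).
      apply: le_trans un; rewrite mulrA normrM (ger0_norm (f0 x)) ler_wpM2r//.
      by apply: le_trans (expNrem_scaled k (u0 n) (ltW x0)) _; exact: ler_norm.
    apply: (@le_trans _ _ (\int[mu]_(x in Rpos) limn_einf (fun n => ((u n) ^- k *
        (expNrem k (u n * x) * f x))%:E))%E).
      rewrite le_eqVlt; apply/orP; left; apply/eqP; apply: eq_integral => x.
      by rewrite inE/= in_itv/= andbT => x0; rewrite pt.
    apply: le_trans (fatou lebesgue_measure (measurable_itv _) (fun n =>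
        measurable_funTS (mI n)) _) _.
      move=> n x; rewrite /= in_itv/= andbT => x0; rewrite lee_fin !mulr_ge0//.
      - by rewrite invr_ge0 exprn_ge0// ltW.
      - by rewrite expNrem_ge0// mulr_ge0// ltW.
    under eq_fun do rewrite I.
    rewrite le_eqVlt; apply/orP; left; apply/eqP; apply: (cvg_limn_einf_sup _).1.
    by apply: cvg_EFin => //; exact: nearW.
  suff H n : ((E k (u n))%:E <= \int[mu]_(x in Rpos) (x ^+ k / k`!%:R * f x)%:E)%E.
    have c : (fun n => (E k (u n))%:E) @ \oo --> (a k)%:E.
      by apply: cvg_EFin => //; exact: nearW.
    rewrite -(cvg_lim _ c)//; apply: lime_le; first by apply/cvg_ex; exists (a k)%:E.
    exact: nearW.
  rewrite -I; apply: ge0_le_integral; [exact: measurable_itv| |exact: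
      measurable_funTS|exact: measurable_funTS|].
  - move=> x; rewrite /= in_itv/= andbT => x0; rewrite lee_fin !mulr_ge0//.
    - by rewrite invr_ge0 exprn_ge0// ltW.
    - by rewrite expNrem_ge0// mulr_ge0// ltW.
  - move=> x; rewrite /= in_itv/= andbT => x0; rewrite lee_fin mulrA ler_wpM2r//.
    rewrite mulrC ler_pdivrMr ?exprn_gt0//.
    apply: le_trans (expNrem_le _ _) _; first by rewrite mulr_ge0// ltW.
    by rewrite exprMn le_eqVlt; apply/orP; left; apply/eqP; ring.
suff rec k v : 0 < v -> v <= 1 ->
    (\int[mu]_(x in Rpos) (expNrem k (v * x) * f x)%:E = (v ^+ k * E k v)%:E)%E.
  by move=> k; apply: mom; exact: rec.
elim: k v => [|k IH] v v0 v1; first by rewrite expr0 mul1r /= H0.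
rewrite (integral_expNremS mf f0 (ltW v0) (mom k IH) (IH v v0 v1)).
rewrite (Erec k)//; congr (_%:E); rewrite exprS; field.
by rewrite pnatr_eq0 -lt0n fact_gt0.
Qed.

(** * The moments of the internal time *)

(** [Gamma_ge] with A^alpha = 2 c + 1. *)
Lemma Gamma_growth (R : realType) (alpha b c : R) : 0 < alpha -> 0 <= b -> 0 <= c ->
  exists2 K : R, 0 <= K &
    forall k : nat, c ^+ k / Gamma (1 + b + alpha * k%:R) <= K * 2^-1 ^+ k.
Proof.
move=> a0 b0 c0; pose A := (2 * c + 1) `^ alpha^-1.
have c1 : 0 < 2 * c + 1 by rewrite ltr_pwDr// mulr_ge0.
have A0 : 0 < A by rewrite powR_gt0.
have A1 : 1 <= A.
  by rewrite -(powRr0 (2 * c + 1)) ler_powR ?invr_ge0 ?(ltW a0)// lerDr mulr_ge0.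
exists (expR A) => [|k]; first exact: expR_ge0.
have z0 : 0 <= b + alpha * k%:R by rewrite addr_ge0// mulr_ge0// ltW.
have z1 : 1 <= 1 + b + alpha * k%:R by rewrite -addrA lerDl.
rewrite ler_pdivrMr; last by rewrite Gamma_gt0// (lt_le_trans ltr01).
have := Gamma_ge A0 z1; rewrite -(ler_pM2l (expR_gt0 A)).
rewrite mulrCA -expRD subrr expR0 mulr1 (_ : 1 + b + alpha * k%:R - 1
    = b + alpha * k%:R); last by ring.
have E : A `^ (alpha * k%:R) = (2 * c + 1) ^+ k.
  by rewrite /A -powRrM mulrA mulVf ?gt_eqF// mul1r powR_mulrn// ltW.
rewrite powRDp// E => H.
rewrite mulrAC -[leLHS](@mulfK _ (2 ^+ k)) ?expf_neq0// -exprMn -exprVn.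
rewrite ler_wpM2r ?exprn_ge0//.
apply: le_trans H; apply: (@le_trans _ _ (1 * (2 * c + 1) ^+ k)).
  rewrite mul1r lerXn2r ?nnegrE ?mulr_ge0 ?(ltW c1)//.
  by rewrite mulrC lerDl.
rewrite ler_wpM2r ?exprn_ge0 ?(ltW c1)//.
by rewrite -(powRr0 A) ler_powR.
Qed.

(** The tails of the Taylor series at 0 of a Laplace transform, in the form
    required by [moments_of_laplace]. *)
Section ShiftedSeries.
Context {R : realType}.
Variables (a : nat -> R) (K : R).
Hypothesis a_ge0 : forall k, 0 <= a k.
Hypothesis a_le : forall k, a k <= K * 2^-1 ^+ k.

Let term (k : nat) (v : R) (j : nat) : R := (- v) ^+ j * a (j + k)%N.

Definition shifted_series (k : nat) (v : R) : R := limn (series (term k v)).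

Let geo_cvg : cvgn (series (fun j => K * 2^-1 ^+ j : R)).
Proof.
have := @is_cvg_geometric_series R K 2^-1; rewrite gtr0_norm ?invr_gt0// invf_lt1// ltr1n.
exact.
Qed.

Let term_le k v j : 0 < v -> v <= 1 -> `|term k v j| <= K * 2^-1 ^+ j.
Proof.
move=> v0 v1; rewrite normrM normrX normrN (gtr0_norm v0) (ger0_norm (a_ge0 _)).
apply: (@le_trans _ _ (1 * a (j + k)%N)).
  by rewrite ler_wpM2r// exprn_ile1// ltW.
rewrite mul1r; apply: le_trans (a_le _) _.
have K0 : 0 <= K by have := le_trans (a_ge0 0) (a_le 0); rewrite expr0 mulr1.
by rewrite ler_wpM2l// ler_wiXn2l ?leq_addr// ?invr_ge0// invf_le1// ler1n//.
Qed.

Let norm_cvg k v : 0 < v -> v <= 1 -> cvgn [normed series (term k v)].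
Proof.
move=> v0 v1; apply: series_le_cvg geo_cvg => j //=; last exact: term_le.
exact: le_trans (term_le k j v0 v1).
Qed.

Lemma shifted_series_le k v : 0 < v -> v <= 1 ->
  `|shifted_series k v| <= limn (series (fun j => K * 2^-1 ^+ j : R)).
Proof.
move=> v0 v1; rewrite /shifted_series.
have H := @lim_series_norm R R (term k v) (norm_cvg v0 v1).
apply: (le_trans H).
apply: lim_series_le => //; first exact: norm_cvg.
by move=> j; exact: term_le.
Qed.

Lemma shifted_seriesE k v : 0 < v -> v <= 1 ->
  shifted_series k v = a k - v * shifted_series k.+1 v.
Proof.
move=> v0 v1; apply/cvg_lim => //; rewrite -cvg_shiftS.
have c : series (term k.+1 v) @ \oo --> shifted_series k.+1 v.
  by have := normed_cvg (norm_cvg v0 v1).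
rewrite (_ : (fun n => _) = (fun n => a k - v * series (term k.+1 v) n)).
  by apply: cvgB; [exact: cvg_cst | exact: cvgMr].
apply/funext => n; rewrite seriesEnat/= big_nat_recl// /term expr0 mul1r add0n;
    congr (_ + _).
rewrite seriesEnat/= mulr_sumr -sumrN; apply: eq_bigr => j _.
by rewrite exprS addnS; ring.
Qed.

End ShiftedSeries.

(** The values of [dens t] outside ]0, +oo[ are arbitrary; extending by zero
    gives a function that is measurable and nonnegative everywhere. *)
Definition dens0 (R : realType) (dens : R -> R -> R) (t : R) : R -> R := dens t \_ Rpos.

(** The Mittag-Leffler series is the Taylor series of the Laplace transform at
    0, and its coefficients decrease geometrically. *)
Lemma dens_moments (R : realType) (alpha : R) (dens : R -> R -> R) (t : R) :
  0 < alpha -> internal_time_density alpha dens -> 0 < t ->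
  has_moments (dens0 dens t)
    (fun k => k`!%:R * ((t `^ alpha) ^+ k / Gamma (1 + alpha * k%:R))).
Proof.
move=> a0 D t0; have [md d0 d1 dL] := D t t0.
have md0 : measurableR (dens0 dens t).
  by apply/(measurable_restrictT _ (measurable_itv _)).
have dd0 x : 0 <= dens0 dens t x.
  by rewrite /dens0 patchE; case: ifPn => //; rewrite inE/= in_itv/= andbT => /d0.
have [K K0 HK] := Gamma_growth a0 (lexx 0) (powR_ge0 t alpha).
pose a k := (t `^ alpha) ^+ k / Gamma (1 + alpha * k%:R).
have aK k : a k <= K * 2^-1 ^+ k by have := HK k; rewrite addr0.
have a_ge0 k : 0 <= a k.
  by rewrite divr_ge0 ?exprn_ge0 ?powR_ge0// ltW// Gamma_gt0// ltr_pwDl// mulr_ge0// ltW.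
apply: (moments_of_laplace (a := a) (E := shifted_series a)
  (C := limn (series (fun j => K * 2^-1 ^+ j : R))) md0 dd0).
- by move=> k v; exact: (shifted_seriesE a_ge0 aK).
- by move=> k v; exact: (shifted_series_le a_ge0 aK).
move=> v v0 v1.
have -> : shifted_series a 0 v = mittag_leffler alpha (- (v * t `^ alpha)).
  rewrite /shifted_series /mittag_leffler; congr (limn (series _)); apply/funext => j.
  by rewrite addn0 -mulNr exprMn mulrA.
rewrite -dL ?(ltW v0)// /Rintegral fineK.
  by apply: eq_integral => x xp; congr (_%:E); rewrite /dens0 patchE xp.
apply: integrable_fin_num; first exact: measurable_itv.
have id : mu.-integrable Rpos (fun x => (dens0 dens t x)%:E).
  apply: (integrable_ge0 (c := 1) (measurable_itv _)) => //.
  by rewrite -d1; apply: eq_integral => x xp; rewrite /dens0 patchE xp.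
apply: (le_integrable _ _ _ id); first exact: measurable_itv.
  apply/measurable_EFinP; apply: measurable_funM; last exact: md.
  by apply: measurable_funTS; meas.
move=> x; rewrite /= in_itv/= andbT => x0.
rewrite lee_fin /dens0 patchE mem_setE/= in_itv/= x0 normrM ger0_norm ?expR_ge0//.
by rewrite ler_piMl// -expR0 ler_expR oppr_le0 mulr_ge0// ltW//.
Qed.

(** * Uniqueness for the Laplace transform *)

Lemma bernoulli_ineq (R : realType) (a : R) (N : nat) : 0 <= a -> a <= 1 ->
  1 - N%:R * a <= (1 - a) ^+ N.
Proof.
move=> a0 a1; have b0 : 0 <= 1 - a by rewrite subr_ge0.
elim: N => [|N IH]; first by rewrite mul0r subr0 expr0.
rewrite exprS; apply: le_trans (ler_wpM2l b0 IH).
rewrite -subr_ge0 -natr1 (_ : _ - _ = N%:R * a ^+ 2); last by ring.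
by rewrite mulr_ge0// sqr_ge0.
Qed.

Lemma expR_le_inv (R : realType) (x : R) : 0 < x -> expR (- x) <= x^-1.
Proof.
move=> x0; rewrite expRN lef_pV2 ?posrE ?expR_gt0//.
by apply: le_trans (expR_ge1Dx x); rewrite lerDr.
Qed.

(** For v = ln 2 / y this combination of exponentials exp(-j n v x) tends to the
    indicator of x > y: it is about exp(- r^n), where r = 2 exp(-v x) exceeds 1
    before y and is below 1 after y. *)
Definition sharp_step (R : realType) (v : R) (n : nat) (x : R) : R :=
  (1 - expR (- (n%:R * v * x))) ^+ (2 ^ n).

Lemma sharp_step_bounds (R : realType) (v x : R) n : 0 <= v -> 0 <= x ->
  0 <= sharp_step v n x <= 1.
Proof.
move=> v0 x0; have e1 : expR (- (n%:R * v * x)) <= 1.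
  by rewrite expR_le1 oppr_le0 !mulr_ge0.
by rewrite exprn_ge0 ?subr_ge0//= exprn_ile1 ?subr_ge0// lerBlDr lerDl expR_ge0.
Qed.

Lemma sharp_step_cvg (R : realType) (y x : R) : 0 < y -> 0 < x -> x != y ->
  sharp_step (ln 2 / y) n x @[n --> \oo] --> ((y < x)%R%:R : R).
Proof.
move=> y0 x0 xy; pose v := ln 2 / y.
have l2 : 0 < ln 2 :> R by rewrite ln_gt0// ltr1n.
have v0 : 0 < v by rewrite divr_gt0.
pose r := expR (ln 2 - v * x).
have rE n : (2 ^ n)%:R * expR (- (n%:R * v * x)) = r ^+ n.
  rewrite natrX -{1}(@lnK _ 2) ?posrE// -!expRM_natl -expRD; congr expR.
  by rewrite -mulr_natl; ring.
have e1 n : expR (- (n%:R * v * x)) <= 1.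
  by rewrite expR_le1 oppr_le0 mulr_ge0 ?(ltW x0)// mulr_ge0 ?(ltW v0).
have r0 : 0 < r by exact: expR_gt0.
case: ltgtP xy => // [xy _|xy _] /=; last first.
  have r1 : 1 < r.
    rewrite /r expR_gt1 subr_gt0 /v mulrAC ltr_pdivrMr//.
    by rewrite (ltr_pM2l l2).
  apply: (@squeeze_cvgr _ _ _ _ (cst 0) (fun n => (r^-1) ^+ n)).
  - apply: nearW => n /=; rewrite exprn_ge0 ?subr_ge0//=.
    rewrite exprVn -rE.
    apply: le_trans (expR_le_inv _); last by rewrite rE exprn_gt0.
    rewrite -mulrN expRM_natl lerXn2r ?nnegrE ?subr_ge0 ?expR_ge0//.
    exact: expR_ge1Dx.
  - exact: cvg_cst.
  - have := @cvg_geometric R 1 r^-1; rewrite gtr0_norm ?invr_gt0// invf_lt1// => /(_ r1).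
    by rewrite /geometric/=; under eq_fun do rewrite mul1r.
have r1 : r < 1.
  rewrite /r expR_lt1 subr_lt0 /v mulrAC ltr_pdivlMr//.
  by rewrite (ltr_pM2l l2).
apply: (@squeeze_cvgr _ _ _ _ (fun n => 1 - r ^+ n) (cst 1)).
- apply: nearW => n /=; rewrite -rE bernoulli_ineq ?expR_ge0//=.
  by have /andP[] := sharp_step_bounds n (ltW v0) (ltW x0).
- rewrite -[X in _ --> X]subr0; apply: cvgB; first exact: cvg_cst.
  have := @cvg_geometric R 1 r; rewrite gtr0_norm// => /(_ r1).
  by rewrite /geometric/=; under eq_fun do rewrite mul1r.
- exact: cvg_cst.
Qed.

(** Each factor of the power subtracts a Laplace transform at a shifted
    argument, so that the power is expanded by induction. *)
Lemma laplace_sharp_step (R : realType) (u : R -> R) :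
  measurableR u ->
  mu.-integrable Rpos (fun x => (u x)%:E) ->
  (forall v, 0 <= v -> (\int[mu]_(x in Rpos) (expR (- (v * x)) * u x)%:E = 0)%E) ->
  forall v n, 0 <= v -> (\int[mu]_(x in Rpos) (sharp_step v n x * u x)%:E = 0)%E.
Proof.
move=> mu' iu L v n v0.
have c0 : 0 <= n%:R * v by rewrite mulr_ge0.
pose g (N : nat) w x := expR (- (w * x)) * (1 - expR (- (n%:R * v * x))) ^+ N.
have mg N w : measurableR (g N w).
  by rewrite /g; meas.
have g1 N w : 0 <= w -> forall x, Rpos x -> `|g N w x| <= 1.
  move=> w0 x; rewrite /= in_itv/= andbT => x0.
  have e1 : expR (- (n%:R * v * x)) <= 1.
    by rewrite expR_le1 oppr_le0 mulr_ge0// ltW.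
  rewrite normrM ger0_norm ?expR_ge0// mulr_ile1 ?expR_ge0//.
    by rewrite expR_le1 oppr_le0 mulr_ge0// ltW.
  by rewrite ger0_norm ?exprn_ge0 ?subr_ge0// exprn_ile1 ?subr_ge0// lerBlDr lerDl expR_ge0.
have ig N w : 0 <= w -> mu.-integrable Rpos (fun x => (g N w x * u x)%:E).
  by move=> w0; apply: (integrable_bounded_mul (measurable_itv _)) => //; exact: g1.
suff H N w : 0 <= w -> (\int[mu]_(x in Rpos) (g N w x * u x)%:E = 0)%E.
  rewrite -(H (2 ^ n)%N 0)//; apply: eq_integral => x _; rewrite /g/sharp_step.
  by rewrite mul0r oppr0 expR0 mul1r.
elim: N w => [|N IH] w w0.
  by rewrite -(L w w0); apply: eq_integral => x _; rewrite /g expr0 mulr1.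
have w1 : 0 <= w + n%:R * v by rewrite addr_ge0.
transitivity (\int[mu]_(x in Rpos) ((g N w x * u x)%:E -
    (g N (w + n%:R * v) x * u x)%:E))%E.
  apply: eq_integral => x _; rewrite -EFinB; congr (_%:E).
  rewrite /g exprS (_ : expR (- ((w + n%:R * v) * x)) =
      expR (- (w * x)) * expR (- (n%:R * v * x))).
    by ring.
  by rewrite mulrDl opprD expRD.
rewrite integralB; [|exact: measurable_itv|exact: ig|exact: ig].
by rewrite !IH// sube0.
Qed.

Lemma laplace_tail_eq0 (R : realType) (u : R -> R) :
  measurableR u ->
  mu.-integrable Rpos (fun x => (u x)%:E) ->
  (forall v, 0 <= v -> (\int[mu]_(x in Rpos) (expR (- (v * x)) * u x)%:E = 0)%E) ->
  forall y, 0 < y -> (\int[mu]_(x in `]y, +oo[) (u x)%:E = 0)%E.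
Proof.
move=> mu' iu L y y0; pose v := ln 2 / y.
have v0 : 0 < v by rewrite divr_gt0// ln_gt0// ltr1n.
have mlt : measurableR (fun x : R => (y < x)%R%:R : R).
  rewrite (_ : (fun x => _) = (fun x => if y < x then 1 else 0)); last first.
    by apply/funext => x; case: ifP.
  by apply: measurable_fun_ifT => //; apply: measurable_fun_ltr; meas.
have ms n : measurableR (sharp_step v n).
  by rewrite /sharp_step; meas.
have [||||_ _ c] := @dominated_convergence _ _ R mu Rpos (measurable_itv _)
    (fun n x => (sharp_step v n x * u x)%:E) (fun x => ((y < x)%R%:R * u x)%:E)
    (fun x => `|(u x)%:E|%E) _ _ _ (integrable_abse iu) _.
- by move=> n; have msn := ms n; apply: measurable_funTS; meas.
- by apply: measurable_funTS; meas.
- have ny : {ae mu, forall x, x != y}.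
    exists [set y]; split => //; first exact: lebesgue_measure_set1.
    by move=> x /= /negP; rewrite negbK => /eqP.
  apply: ae_imp ny => x xy; rewrite /= in_itv/= andbT => x0.
  by apply: cvg_EFin; [exact: nearW|apply: cvgMl; exact: sharp_step_cvg].
- apply: aeW => x n; rewrite /= in_itv/= andbT => x0; rewrite lee_fin normrM ler_piMl//.
  by have /andP[s0 s1] := sharp_step_bounds n (ltW v0) (ltW x0); rewrite ger0_norm.
have E0 : (\int[mu]_(x in Rpos) ((y < x)%R%:R * u x)%:E = 0)%E.
  apply: (cvg_unique _ c) => //; rewrite (_ : (fun n => _) = cst 0%E); first exact: cvg_cst.
  by apply/funext => n; apply: laplace_sharp_step => //; exact: ltW.
rewrite (itv_oy_Rpos (ltW y0)) integral_mkcondr -[RHS]E0; apply: eq_integral => x _.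
by rewrite patchE mem_setE in_itv/= andbT; case: ifPn => _; rewrite ?mul1r ?mul0r.
Qed.

(** All the integrals over half-lines ]y, +oo[ vanish, and Lebesgue
    differentiation concludes. *)
Lemma laplace_inj (R : realType) (u : R -> R) :
  measurableR u ->
  mu.-integrable Rpos (fun x => (u x)%:E) ->
  (forall v, 0 <= v -> (\int[mu]_(x in Rpos) (expR (- (v * x)) * u x)%:E = 0)%E) ->
  {ae mu, forall x, 0 < x -> u x = 0}.
Proof.
move=> mu' iu L; have T := laplace_tail_eq0 mu' iu L.
pose w := u \_ Rpos.
have iw : mu.-integrable setT (EFin \o w).
  have := @integrable_mkcond _ _ R mu Rpos (EFin \o u) (measurable_itv _).
  by rewrite restrict_EFin => -[+ _]; exact.
have iwD (D : set (measurableTypeR R)) : measurable D -> mu.-integrable D (EFin \o w).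
  by move=> mD; apply: integrableS iw.
have locw : locally_integrable [set: R] w.
  by apply: integrable_locally iu; exact: measurable_itv.
have := FTC1Ny (fun y => iwD _ (measurable_itv _)) locw.
apply: ae_imp => x [_ dx] x0.
have -> : u x = w x by rewrite /w patchE mem_setE in_itv/= x0.
rewrite -dx derive1E.
have Rw (y : R) : 0 < y -> \int[mu]_(t in `]-oo, y]) w t = \int[mu]_(t in `]-oo, +oo[) w t.
  move=> y0; apply/eqP; rewrite eq_sym -subr_eq0.
  rewrite Rintegral_itvB//; last exact: iwD (measurable_itv _).
  rewrite /Rintegral (_ : (\int[mu]_(x in _) _)%E = 0%E)// -(T y y0).
  apply: eq_integral => z; rewrite inE/= in_itv/= andbT => yz.
  by rewrite /w patchE mem_setE in_itv/= (lt_trans y0 yz).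
rewrite (@near_eq_derive _ _ _ _ (cst (\int[mu]_(t in `]-oo, +oo[) w t))).
  by rewrite -derive1E derive1_cst.
near=> y; apply: Rw; near: y; exact: lt_nbhsr.
Unshelve. all: by end_near. Qed.

(** * Determinacy by moments *)

Definition moments_summable (R : realType) (m : nat -> R) : Prop :=
  forall v : R, 0 <= v -> v ^+ k * m k / k`!%:R @[k --> \oo] --> (0 : R).

Lemma has_moments_integrable (R : realType) (f : R -> R) (m : nat -> R) :
  has_moments f m -> mu.-integrable Rpos (fun x => (f x)%:E).
Proof.
move=> [mf f0 Hm]; apply: (integrable_ge0 (c := m 0%N) (measurable_itv _)) => //.
by rewrite -(Hm 0%N); apply: eq_integral => x _; rewrite expr0 mul1r.
Qed.

(** J k is the integral of the k-th Taylor remainder of exp(-v x) against f. *)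
Lemma laplace_remainder (R : realType) (f : R -> R) (m : nat -> R) (v : R) :
  has_moments f m -> 0 <= v -> exists J : nat -> R,
  [/\ (\int[mu]_(x in Rpos) (expR (- (v * x)) * f x)%:E = (J 0%N)%:E)%E,
      forall k, J k.+1 = v ^+ k * m k / k`!%:R - J k & forall k, 0 <= J k].
Proof.
move=> Hf v0; have [mf f0 Hm] := Hf.
pose J (k : nat) : R := fine (\int[mu]_(x in Rpos) (expNrem k (v * x) * f x)%:E)%E.
have i0 : mu.-integrable Rpos (fun x => (expNrem 0 (v * x) * f x)%:E).
  apply: (integrable_bounded_mul (measurable_itv _)) => //;
      last exact: has_moments_integrable Hf.
    by rewrite /=; meas.
  move=> x; rewrite /= in_itv/= andbT => x0.
  by rewrite ger0_norm ?expR_ge0// expR_le1 oppr_le0 mulr_ge0// ltW.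
have JE k : (\int[mu]_(x in Rpos) (expNrem k (v * x) * f x)%:E = (J k)%:E)%E.
  elim: k => [|k IH]; first by rewrite /J fineK// integrable_fin_num.
  by rewrite [in RHS]/J (integral_expNremS mf f0 v0 (Hm k) IH).
exists J; split; first exact: (JE 0%N).
  by move=> k; rewrite [LHS]/J (integral_expNremS mf f0 v0 (Hm k) (JE k)).
move=> k; rewrite fine_ge0//; apply: integral_ge0 => x; rewrite /= in_itv/= andbT => x0.
by rewrite lee_fin mulr_ge0// expNrem_ge0// mulr_ge0// ltW.
Qed.

(** By the recursion, passing from one remainder to the next changes only the
    sign of the difference of the two integrals. This difference is thus the
    one of the Laplace transforms up to sign, and is at most v^k m_k / k! for
    every k. *)
Lemma has_moments_unique (R : realType) (f g : R -> R) (m : nat -> R) :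
  moments_summable m -> has_moments f m -> has_moments g m ->
  {ae @lebesgue_measure R, forall x, 0 < x -> f x = g x}.
Proof.
move=> Sm Hf Hg; have [mf f0 _] := Hf; have [mg g0 _] := Hg.
suff : {ae @lebesgue_measure R, forall x, 0 < x -> f x - g x = 0}.
  by apply: ae_imp => x H x0; apply/eqP; rewrite -subr_eq0 H.
have i_f := has_moments_integrable Hf; have i_g := has_moments_integrable Hg.
apply: laplace_inj; first by meas.
  by rewrite (_ : (fun x => _) = ((fun x => (f x)%:E) \- (fun x => (g x)%:E))%E)//;
      exact: integrableB.
move=> v v0.
have [J [J0 JS Jge]] := laplace_remainder Hf v0.
have [K [K0 KS Kge]] := laplace_remainder Hg v0.
have bd (g' : R -> R) : measurableR g' ->
  mu.-integrable Rpos (fun x => (g' x)%:E) ->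
  mu.-integrable Rpos (fun x => (expR (- (v * x)) * g' x)%:E).
  move=> mg' ig'; apply: (integrable_bounded_mul (measurable_itv _)) => //; first by meas.
  move=> x; rewrite /= in_itv/= andbT => x0.
  by rewrite ger0_norm ?expR_ge0// expR_le1 oppr_le0 mulr_ge0// ltW.
transitivity (\int[mu]_(x in Rpos) ((expR (- (v * x)) * f x)%:E -
    (expR (- (v * x)) * g x)%:E))%E.
  by apply: eq_integral => x _; rewrite -EFinB mulrBr.
rewrite integralB; [|exact: measurable_itv|exact: bd|exact: bd].
rewrite J0 K0 -EFinB; congr (_%:E).
have D k : `|J k - K k| = `|J 0%N - K 0%N|.
  elim: k => // k <-; rewrite JS KS -normrN; congr (`|_|); ring.
have B k : `|J 0%N - K 0%N| <= v ^+ k * m k / k`!%:R.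
  rewrite -(D k) ler_norml; apply/andP; split.
    rewrite lerNl opprB lerBlDr (le_trans (y := v ^+ k * m k / k`!%:R))// ?lerDl//.
    by rewrite -subr_ge0 -KS.
  by rewrite lerBlDr (le_trans (y := v ^+ k * m k / k`!%:R))// ?lerDl// -subr_ge0 -JS.
apply/eqP; rewrite -normr_le0.
have c := Sm v v0; rewrite -(cvg_lim _ c)//; apply: limr_ge; first by apply/cvg_ex;
    exists 0.
exact: nearW.
Qed.

(** [F] is allowed infinite values, being itself an integral in the
    applications; its total mass m 0 makes it finite almost everywhere. *)
Lemma moments_determinate (R : realType) (F : R -> \bar R) (g : R -> R) (m : nat -> R) :
  measurableR F -> (forall x, 0 <= F x)%E ->
  (forall k, \int[mu]_(x in Rpos) ((x ^+ k)%:E * F x) = (m k)%:E)%E ->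
  moments_summable m -> has_moments g m ->
  {ae @lebesgue_measure R, forall x, 0 < x -> F x = (g x)%:E}.
Proof.
move=> mF F0 Hm Sm Hg.
have iF : mu.-integrable Rpos F.
  apply/integrableP; split; first exact: measurable_funTS.
  have -> : (\int[mu]_(x in Rpos) `|F x| = (m 0%N)%:E)%E; last by rewrite ltry.
  by rewrite -Hm; apply: eq_integral => x _; rewrite expr0 mul1e gee0_abs.
have fF : {ae @lebesgue_measure R, forall x, 0 < x -> F x \is a fin_num}.
  have mD : measurable (Rpos : set (measurableTypeR R)) by exact: measurable_itv.
  have := integrable_ae mD iF.
  by apply: ae_imp => x H x0; apply: H; rewrite /= in_itv/= x0.
have mfF : measurableR (fine \o F).
  exact: measurableT_comp.
have Hf : has_moments (fine \o F) m.
  split=> //.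
    by move=> x /=; rewrite fine_ge0.
  move=> k; rewrite -Hm; apply: ae_eq_integral.
  - exact: measurable_itv.
  - by apply: measurable_funTS; meas.
  - by apply: measurable_funTS; apply: emeasurable_funM => //; meas.
  - apply: ae_imp fF => x H; rewrite /= in_itv/= andbT => x0.
    by rewrite EFinM fineK// H.
have Fae := ae_filter_ringOfSetsType (@lebesgue_measure R).
have both := @filterI _ _ Fae _ _ fF (has_moments_unique Sm Hf Hg).
by apply: ae_imp both => x [H1 H2] x0; rewrite -H2//= fineK// H1.
Qed.

Lemma Gamma_moments_summable (R : realType) (alpha b c C : R) :
  0 < alpha -> 0 <= b -> 0 <= c -> 0 <= C ->
  moments_summable (fun k => k`!%:R * (C * (c ^+ k / Gamma (1 + b + alpha * k%:R)))).
Proof.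
move=> a0 b0 c0 C0 v v0.
have [K K0 HK] := Gamma_growth a0 b0 (mulr_ge0 v0 c0).
apply: (@squeeze_cvgr _ _ _ _ (cst 0) (fun k => C * (K * 2^-1 ^+ k))).
- apply: nearW => k /=.
  have G0 : 0 < Gamma (1 + b + alpha * k%:R).
    by rewrite Gamma_gt0// -addrA ltr_pwDl// addr_ge0// mulr_ge0// ltW.
  rewrite (_ : _ / k`!%:R = C * ((v * c) ^+ k / Gamma (1 + b + alpha * k%:R))).
    by rewrite ler_wpM2l// andbT mulr_ge0// divr_ge0 ?(ltW G0)// exprn_ge0// mulr_ge0.
  have := lt0r_neq0 G0; move: (Gamma _) => G G1; rewrite exprMn; field.
  by rewrite G1 pnatr_eq0 -lt0n fact_gt0.
- exact: cvg_cst.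
- rewrite -(mulr0 C); apply: cvgMr.
  have := @cvg_geometric R K 2^-1; rewrite gtr0_norm ?invr_gt0// invf_lt1// ltr1n; exact.
Qed.

(** * Fractional integrals of the passage density *)

(** If [M] is the density of S(1), the self-similarity S(s) = s^alpha S(1) gives
    P(S(s) > tau) as the integral of [M] beyond tau s^(-alpha); this is its
    derivative in s, the density of the time at which S crosses the level tau.
    Only the density at time 1 enters, so that the kernel is measurable in both
    variables together. *)
Definition hit (R : realType) (alpha : R) (M : R -> R) (tau s : R) : R :=
  alpha * tau * s `^ (-1 - alpha) * M (tau * s `^ (- alpha)).

(** Gamma(beta) times the Riemann-Liouville integral of order beta, in the time
    variable, of the passage density. *)
Definition fracint (R : realType) (alpha : R) (M : R -> R) (beta t tau : R) : \bar R :=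
  (\int[mu]_(s in `]0%R, t[) ((t - s) `^ (beta - 1) * hit alpha M tau s)%:E)%E.

Lemma measurable_hit (R : realType) (alpha : R) (M : R -> R) :
  measurableR M ->
  measurable_fun setT
    (fun z : measurableTypeR R * measurableTypeR R => hit alpha M z.1 z.2).
Proof.
move=> mM; have mp : measurable_fun setT (fun z :
    measurableTypeR R * measurableTypeR R => z.1 * z.2 `^ (- alpha)).
  by meas.
have mMp := measurableT_comp mM mp.
rewrite /hit; apply: measurable_funM => //; meas.
Qed.

Lemma hit_ge0 (R : realType) (alpha : R) (M : R -> R) (tau s : R) :
  0 < alpha -> (forall u, 0 <= M u) -> (forall u, u <= 0 -> M u = 0) ->
  0 <= hit alpha M tau s.
Proof.
move=> a0 M0 MN; rewrite /hit; have [tau0|tau0] := leP tau 0.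
  by rewrite [M _]MN ?mulr0// mulr_le0_ge0// powR_ge0.
by rewrite !mulr_ge0 ?powR_ge0// ltW.
Qed.

(** The substitution u = tau s^(-alpha) reduces to the moment of order k + 1 of
    [M]. *)
Lemma hit_moments (R : realType) (alpha : R) (M : R -> R) (k : nat) (s : R) :
  0 < alpha -> 0 < s ->
  has_moments M (fun k => k`!%:R / Gamma (1 + alpha * k%:R)) ->
  (\int[mu]_(tau in Rpos) (tau ^+ k * hit alpha M tau s)%:E
   = (s `^ (alpha * k.+1%:R - 1) * (k`!%:R / Gamma (alpha * k.+1%:R)))%:E)%E.
Proof.
move=> a0 s0 [mM M0 HM]; set c := s `^ (- alpha).
have c0 : 0 < c by rewrite powR_gt0.
pose F (u : R) : \bar R := ((alpha * s `^ (-1 - alpha) * c ^- k.+1) * (u ^+ k.+1 * M u))%:E.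
have mF : measurableR F by rewrite /F; meas.
have B0 : 0 <= alpha * s `^ (-1 - alpha) * c ^- k.+1.
  by rewrite mulr_ge0 ?invr_ge0 ?exprn_ge0 ?(ltW c0)// mulr_ge0 ?powR_ge0// ltW.
have F0 u : 0 < u -> (0 <= F u)%E.
  by move=> u0; rewrite lee_fin mulr_ge0// mulr_ge0// exprn_ge0// ltW.
have z0 : 0 < alpha * k.+1%:R by rewrite mulr_gt0.
have IF : (\int[mu]_(u in Rpos) F u = (alpha * s `^ (-1 - alpha) * c ^- k.+1 *
    (k.+1`!%:R / Gamma (1 + alpha * k.+1%:R)))%:E)%E.
  rewrite EFinM -HM -ge0_integralZl.
  - by [].
  - exact: measurable_itv.
  - by apply: measurable_funTS; meas.
  - by move=> x; rewrite /= in_itv/= andbT => x0;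
        rewrite lee_fin mulr_ge0// exprn_ge0// ltW.
  - by rewrite lee_fin.
transitivity (\int[mu]_(tau in Rpos) F (c * tau)%R)%E.
  apply: eq_integral => tau; rewrite inE/= in_itv/= andbT => tau0.
  congr (_%:E); rewrite /hit -/c (mulrC c tau) exprMn (exprS tau).
  have : c ^+ k.+1 != 0 by rewrite expf_neq0// gt_eqF.
  by move: (c ^+ k.+1) => C C0; field.
have SC := ge0_integral_scale c0 (measurable_funTS mF) F0; rewrite IF in SC.
have -> : (\int[mu]_(x in Rpos) F (c * x)%R =
    (c^-1)%:E * (c%:E * \int[mu]_(x in Rpos) F (c * x)%R))%E.
  by rewrite muleA -EFinM mulVf ?mul1e// gt_eqF.
rewrite SC -EFinM; congr (_%:E).
rewrite (addrC 1) GammaD1// factS natrM.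
have g0 := Gamma_gt0 z0.
have -> : s `^ (alpha * k.+1%:R - 1) = s `^ (-1 - alpha) * c ^- k.+1 * c^-1.
  rewrite -mulrA -invfM -exprSr /c -powR_mulrn ?powR_ge0// -powRrM -powRN -powRDp//.
  by congr (_ `^ _); rewrite -natr1; ring.
have := lt0r_neq0 g0; move: (Gamma _) => G G0; field.
by rewrite nat1r G0 !gt_eqF// exprn_gt0.
Qed.

Section FractionalIntegral.
Context {R : realType}.
Variables (alpha : R) (M : R -> R).
Hypothesis alpha_gt0 : 0 < alpha.
Hypothesis M_ge0 : forall u, 0 <= M u.
Hypothesis M_eq0 : forall u, u <= 0 -> M u = 0.
Hypothesis M_moments : has_moments M (fun k => k`!%:R / Gamma (1 + alpha * k%:R)).

Let mM : measurableR M.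
Proof. by have [] := M_moments. Qed.

Let integrand_ge0 beta t tau s : 0 <= (t - s) `^ (beta - 1) * hit alpha M tau s.
Proof. by rewrite mulr_ge0 ?powR_ge0// hit_ge0. Qed.

Lemma measurable_fracint_kernel beta t : measurable_fun setT
  (fun z : measurableTypeR R * measurableTypeR R =>
     (t - z.2) `^ (beta - 1) * hit alpha M z.1 z.2).
Proof.
apply: measurable_funM; last exact: measurable_hit.
by meas.
Qed.

Lemma fracint_ge0 beta t tau : (0 <= fracint alpha M beta t tau)%E.
Proof. by apply: integral_ge0 => s _; rewrite lee_fin. Qed.

Lemma measurable_fracint beta t :
  measurableR (fracint alpha M beta t).
Proof.
pose G := (fun z : measurableTypeR R * measurableTypeR R =>
  if (0 < z.2) && (z.2 < t) then
    ((t - z.2) `^ (beta - 1) * hit alpha M z.1 z.2)%:E else 0%E).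
rewrite (_ : fracint alpha M beta t = fubini_F lebesgue_measure G); last first.
  apply/funext => tau; rewrite /fracint integral_mkcond; apply: eq_integral => s _.
  by rewrite patchE mem_setE in_itv.
apply: measurable_fun_fubini_tonelli_F.
- apply: measurable_fun_ifT => //; last by apply/measurable_EFinP;
      exact: measurable_fracint_kernel.
  by apply: measurable_and; apply: measurable_fun_ltr; meas.
- by move=> z; rewrite /G; case: ifP => // _; rewrite lee_fin integrand_ge0.
Qed.

(** By Tonelli's theorem and [hit_moments], this is a Beta integral. *)
Lemma fracint_moments (k : nat) beta t : 0 < beta -> 0 < t ->
  (\int[mu]_(tau in Rpos) ((tau ^+ k)%:E * fracint alpha M beta t tau)
   = (t `^ (alpha * k.+1%:R + beta - 1) *
      (k`!%:R * Gamma beta / Gamma (alpha * k.+1%:R + beta)))%:E)%E.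
Proof.
move=> b0 t0; have z0 : 0 < alpha * k.+1%:R by rewrite mulr_gt0.
have mk := measurable_fracint_kernel beta t.
have mks tau : measurableR (fun s : R => ((t - s) `^ (beta - 1) * hit alpha M tau s)).
  exact: (measurable_fun_pair2 tau mk).
have mht s : measurableR (fun tau : R => hit alpha M tau s).
  exact: (measurable_fun_pair1 s (measurable_hit alpha mM)).
transitivity (\int[mu]_(tau in Rpos) \int[mu]_(s in `]0%R, t[)
    (tau ^+ k * ((t - s) `^ (beta - 1) * hit alpha M tau s))%:E)%E.
  apply: eq_integral => tau; rewrite inE/= in_itv/= andbT => tau0.
  rewrite /fracint -ge0_integralZl.
  - by [].
  - exact: measurable_itv.
  - by apply: measurable_funTS; apply/measurable_EFinP; exact: mks.
  - by move=> s _; rewrite lee_fin.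
  - by rewrite lee_fin exprn_ge0// ltW.
rewrite (tonelli_on (f := fun tau s =>
    (tau ^+ k * ((t - s) `^ (beta - 1) * hit alpha M tau s))%:E)); last 4 first.
- exact: measurable_itv.
- exact: measurable_itv.
- apply: measurable_funTS; apply/measurable_EFinP; apply: measurable_funM => //.
  by meas.
- by move=> tau s; rewrite /= in_itv/= andbT => tau0 _;
      rewrite lee_fin mulr_ge0// exprn_ge0// ltW.
transitivity (\int[mu]_(s in `]0%R, t[) ((k`!%:R / Gamma (alpha * k.+1%:R))%:E *
    (s `^ (alpha * k.+1%:R - 1) * (t - s) `^ (beta - 1))%:E))%E.
  apply: eq_integral => s; rewrite inE/= in_itv/= => /andP[s0 st].
  transitivity (((t - s) `^ (beta - 1))%:E * \int[mu]_(tau in Rpos)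
      (tau ^+ k * hit alpha M tau s)%:E)%E.
    rewrite -ge0_integralZl.
    - by apply: eq_integral => tau _; rewrite -EFinM; congr (_%:E); ring.
    - exact: measurable_itv.
    - have mhs := mht s; by apply: measurable_funTS; apply/measurable_EFinP;
          apply: measurable_funM => //; meas.
    - move=> tau; rewrite /= in_itv/= andbT => tau0.
      by rewrite lee_fin mulr_ge0 ?hit_ge0// exprn_ge0// ltW.
    - by rewrite lee_fin powR_ge0.
  by rewrite (hit_moments k alpha_gt0 s0 M_moments) -!EFinM; congr (_%:E); ring.
rewrite ge0_integralZl.
- rewrite beta_integral// -EFinM; congr (_%:E).
  have := lt0r_neq0 (Gamma_gt0 z0); have := lt0r_neq0 (Gamma_gt0 (addr_gt0 z0 b0)).
  move: (Gamma (alpha * k.+1%:R + beta)) (Gamma (alpha * k.+1%:R)) (Gamma beta) =>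
      G1 G2 G3 G10 G20.
  by field; rewrite G10.
- exact: measurable_itv.
- by apply: measurable_funTS; meas.
- by move=> s _; rewrite lee_fin mulr_ge0 ?powR_ge0.
- by rewrite lee_fin divr_ge0// ltW// Gamma_gt0.
Qed.

End FractionalIntegral.

(** * Tails *)

Lemma integral_exprn (R : realType) (k : nat) (y : R) : 0 < y ->
  (\int[mu]_(x in `]0%R, y[) (x ^+ k)%:E = (k.+1%:R^-1 * y ^+ k.+1)%:E)%E.
Proof.
move=> y0; have := integral_powR_oc y0 (ltr0Sn R k).
rewrite -integral_itv_bndo_bndc; last by apply: measurable_funTS; meas.
rewrite powR_mulrn ?(ltW y0)// => <-; apply: eq_integral => x.
rewrite inE/= in_itv/= => /andP[x0 _]; congr (_%:E).
by rewrite -natr1 addrK powR_mulrn// ltW.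
Qed.

Definition tail (R : realType) (f : R -> R) (x : R) : \bar R :=
  (\int[mu]_(y in `]x, +oo[) (f y)%:E)%E.

Section Tail.
Context {R : realType}.
Variables (f : R -> R) (m : nat -> R).
Hypothesis f_moments : has_moments f m.

Let mf : measurableR f.
Proof. by have [] := f_moments. Qed.
Let f0 x : 0 <= f x.
Proof. by have [] := f_moments. Qed.

Lemma tail_ge0 x : (0 <= tail f x)%E.
Proof. by apply: integral_ge0 => y _; rewrite lee_fin. Qed.

Lemma measurable_tail : measurableR (tail f).
Proof.
pose G := (fun z : measurableTypeR R * measurableTypeR R =>
  if z.1 < z.2 then (f z.2)%:E else 0%E).
rewrite (_ : tail f = fubini_F lebesgue_measure G); last first.
  apply/funext => x; rewrite /tail integral_mkcond; apply: eq_integral => y _.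
  by rewrite patchE mem_setE in_itv/= andbT.
apply: measurable_fun_fubini_tonelli_F.
- apply: measurable_fun_ifT => //; last by apply/measurable_EFinP; apply: measurableT_comp.
  by apply: measurable_fun_ltr; meas.
- by move=> z; rewrite /G; case: ifP => // _; rewrite lee_fin.
Qed.

Lemma tail_fin x : 0 < x -> tail f x \is a fin_num.
Proof.
move=> x0; apply: integrable_fin_num; first exact: measurable_itv.
apply: integrableS (has_moments_integrable f_moments); [exact: measurable_itv| |].
  exact: measurable_itv.
by apply: subset_itvr; rewrite bnd_simp ltW.
Qed.

(** Tonelli's theorem: x^k integrates to y^(k+1) / (k+1) over x < y. *)
Lemma tail_moments k :
  (\int[mu]_(x in Rpos) ((x ^+ k)%:E * tail f x) = (m k.+1 / k.+1%:R)%:E)%E.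
Proof.
have [_ _ Hm] := f_moments.
transitivity (\int[mu]_(x in Rpos) \int[mu]_(y in `]x, +oo[) (x ^+ k * f y)%:E)%E.
  apply: eq_integral => x; rewrite inE/= in_itv/= andbT => x0.
  rewrite /tail -ge0_integralZl.
  - by [].
  - exact: measurable_itv.
  - by apply: measurable_funTS; meas.
  - by move=> y _; rewrite lee_fin.
  - by rewrite lee_fin exprn_ge0// ltW.
rewrite (tonelli_triangle (f := fun x y => (x ^+ k * f y)%:E)); last 2 first.
- apply/measurable_EFinP; apply: measurable_funM; first by meas.
  by apply: measurableT_comp.
- by move=> x y x0 _; rewrite lee_fin mulr_ge0// exprn_ge0// ltW.
transitivity (\int[mu]_(y in Rpos) ((k.+1%:R^-1)%:E * (y ^+ k.+1 * f y)%:E))%E.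
  apply: eq_integral => y; rewrite inE/= in_itv/= andbT => y0.
  transitivity ((f y)%:E * \int[mu]_(x in `]0%R, y[) (x ^+ k)%:E)%E.
    rewrite -ge0_integralZl.
    - by apply: eq_integral => x _; rewrite -EFinM mulrC.
    - exact: measurable_itv.
    - by apply: measurable_funTS; meas.
    - by move=> x; rewrite /= in_itv/= => /andP[x0 _]; rewrite lee_fin exprn_ge0// ltW.
    - by rewrite lee_fin.
  by rewrite integral_exprn// -!EFinM; congr (_%:E); ring.
rewrite ge0_integralZl.
- by rewrite Hm -EFinM mulrC.
- exact: measurable_itv.
- by apply: measurable_funTS; meas.
- by move=> x; rewrite /= in_itv/= andbT => x0; rewrite lee_fin mulr_ge0// exprn_ge0// ltW.
- by rewrite lee_fin invr_ge0.
Qed.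

Lemma tail_has_moments :
  has_moments (fun x => if 0 < x then fine (tail f x) else 0) (fun k => m k.+1 / k.+1%:R).
Proof.
split.
- apply: measurable_fun_ifT; [by apply: measurable_fun_ltr; meas| |by meas].
  by apply: measurableT_comp => //; exact: measurable_tail.
- by move=> x; case: ifP => // _; rewrite fine_ge0// tail_ge0.
move=> k; rewrite -tail_moments; apply: eq_integral => x.
rewrite inE/= in_itv/= andbT => x0.
by rewrite x0 EFinM fineK// tail_fin.
Qed.

End Tail.

(** * Two identities for the passage density *)

Section Identities.
Context {R : realType}.
Variables (alpha : R) (dens : R -> R -> R).
Hypothesis alpha_gt0 : 0 < alpha.
Hypothesis alpha_lt1 : alpha < 1.
Hypothesis D : internal_time_density alpha dens.

Let M := dens0 dens 1.

Lemma dens0_eq0 t u : u <= 0 -> dens0 dens t u = 0.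
Proof. by move=> u0; rewrite /dens0 patchE mem_setE in_itv/= andbT ltNge u0. Qed.

Lemma dens0_ge0 t u : 0 < t -> 0 <= dens0 dens t u.
Proof. by move=> t0; have [_ +] := dens_moments alpha_gt0 D t0; exact. Qed.

Lemma dens1_moments : has_moments M (fun k => k`!%:R / Gamma (1 + alpha * k%:R)).
Proof.
have := dens_moments alpha_gt0 D ltr01; rewrite -/M.
by under eq_fun do rewrite powR1 expr1n mul1r.
Qed.

(** Both sides have the moments k! Gamma(1 - alpha) t^(alpha k)
    / Gamma(1 + alpha k). *)
Lemma fracint_dens t : 0 < t -> {ae @lebesgue_measure R, forall tau, 0 < tau ->
  fracint alpha M (1 - alpha) t tau = (Gamma (1 - alpha) * dens0 dens t tau)%:E}.
Proof.
move=> t0; have a1 : 0 < 1 - alpha by rewrite subr_gt0.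
have G0 := ltW (Gamma_gt0 a1).
have M0 u : 0 <= M u by apply: dens0_ge0.
have MN u : u <= 0 -> M u = 0 by exact: dens0_eq0.
have [md d0 Hd] := dens_moments alpha_gt0 D t0.
pose m (k : nat) := k`!%:R *
  (Gamma (1 - alpha) * ((t `^ alpha) ^+ k / Gamma (1 + 0 + alpha * k%:R))).
apply: (moments_determinate (m := m)).
- exact: measurable_fracint dens1_moments _ _.
- by move=> tau; exact: fracint_ge0.
- move=> k; rewrite (fracint_moments alpha_gt0 M0 MN dens1_moments)// /m; congr (_%:E).
  rewrite (_ : alpha * k.+1%:R + (1 - alpha) = 1 + alpha * k%:R); last by rewrite -natr1;
      ring.
  rewrite addr0 (addrC 1) addrK powRrM powR_mulrn ?powR_ge0//.
  by ring.
- apply: Gamma_moments_summable => //; exact: powR_ge0.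
- split; first by meas.
  + by move=> x; rewrite mulr_ge0.
  + move=> k; transitivity ((Gamma (1 - alpha))%:E * \int[mu]_(x in Rpos)
        (x ^+ k * dens0 dens t x)%:E)%E.
      rewrite -ge0_integralZl.
      - by apply: eq_integral => x _; rewrite -EFinM; congr (_%:E); ring.
      - exact: measurable_itv.
      - by apply: measurable_funTS; meas.
      - by move=> x; rewrite /= in_itv/= andbT => x0;
            rewrite lee_fin mulr_ge0// exprn_ge0// ltW.
      - by rewrite lee_fin.
    by rewrite Hd -EFinM /m addr0; congr (_%:E); ring.
Qed.

(** Both sides have the moments k! t^(alpha (k + 1))
    / Gamma(1 + alpha (k + 1)). *)
Lemma fracint_tail t : 0 < t -> {ae @lebesgue_measure R, forall tau, 0 < tau ->
  fracint alpha M 1 t tau = tail (dens0 dens t) tau}.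
Proof.
move=> t0.
have M0 u : 0 <= M u by apply: dens0_ge0.
have MN u : u <= 0 -> M u = 0 by exact: dens0_eq0.
have Hd := dens_moments alpha_gt0 D t0.
pose m (k : nat) := k`!%:R *
  (t `^ alpha * ((t `^ alpha) ^+ k / Gamma (1 + alpha + alpha * k%:R))).
have mE k : k.+1`!%:R * ((t `^ alpha) ^+ k.+1 / Gamma (1 + alpha * k.+1%:R)) / k.+1%:R
    = m k.
  rewrite /m (_ : 1 + alpha + alpha * k%:R = 1 + alpha * k.+1%:R);
      last by rewrite -natr1; ring.
  rewrite factS natrM exprS.
  have : k.+1%:R != 0 :> R by rewrite pnatr_eq0.
  by move: (k.+1%:R) => c c0; move: (Gamma _)^-1 => G; field.
have Ht := tail_has_moments Hd.
have : {ae @lebesgue_measure R, forall tau, 0 < tau ->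
    fracint alpha M 1 t tau = (if 0 < tau then fine (tail (dens0 dens t) tau) else 0)%:E}.
  apply: (moments_determinate (m := m)).
  - exact: measurable_fracint dens1_moments _ _.
  - by move=> tau; exact: fracint_ge0.
  - move=> k; rewrite (fracint_moments alpha_gt0 M0 MN dens1_moments)// -mE; congr (_%:E).
    have -> : Gamma (1 : R) = 1 by apply: EFin_inj; rewrite GammaE// EGamma1.
    rewrite (addrC 1 (alpha * k.+1%:R)); move: (Gamma _)^-1 => G.
    rewrite addrK powRrM powR_mulrn ?powR_ge0// mulr1 factS natrM.
    have : k.+1%:R != 0 :> R by rewrite pnatr_eq0.
    by move: (k.+1%:R) => c c0; field.
  - apply: Gamma_moments_summable => //; by rewrite ?powR_ge0 ?(ltW alpha_gt0).
  - have [? ? Hk] := Ht; split=> // k; by rewrite Hk mE.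
by apply: ae_imp => tau H tau0; rewrite H// tau0 fineK// (tail_fin Hd).
Qed.

End Identities.

(** * Caputo derivative of an internal mean *)

Section CaputoInternalMean.
Context {R : realType}.
Variables (alpha : R) (dens : R -> R -> R).
Hypothesis alpha_gt0 : 0 < alpha.
Hypothesis alpha_lt1 : alpha < 1.
Hypothesis D : internal_time_density alpha dens.
Variables f g : R -> R.
Hypothesis f_cont : {within `[0, +oo[, continuous f}.
Hypothesis g_cont : {within `[0, +oo[, continuous g}.
Hypothesis f_derive : forall t : R, 0 < t -> is_derive t 1 f (g t).
Hypothesis f_mean : has_internal_mean dens f.
Hypothesis g_mean : has_internal_mean dens g.

Let M := dens0 dens 1.
Let g0 := g \_ Rpos.
Let h := hit alpha M.
Let alpha1_gt0 : 0 < 1 - alpha. Proof. by rewrite subr_gt0. Qed.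
Let M_ge0 u : 0 <= M u. Proof. exact: (dens0_ge0 alpha_gt0 D u ltr01). Qed.
Let M_eq0 u : u <= 0 -> M u = 0. Proof. exact: dens0_eq0. Qed.
Let M_moments := dens1_moments alpha_gt0 D.
Let measurable_M : measurableR M.
Proof. by have [] := M_moments. Qed.
Let measurable_Rpos : measurable (Rpos : set (measurableTypeR R)).
Proof. exact: measurable_itv. Qed.

Let measurable_g0 : measurableR g0.
Proof.
apply/(measurable_restrictT _ measurable_Rpos).
have mg : measurable_fun (`[0%R, +oo[%classic : set (measurableTypeR R)) g.
  by apply: subspace_continuous_measurable_fun => //; exact: measurable_itv.
apply: measurable_funS mg; first exact: measurable_itv.
by apply: subset_itvr; rewrite bnd_simp.
Qed.

Let h_ge0 tau s : 0 <= h tau s. Proof. exact: hit_ge0. Qed.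
Let measurable_h : measurable_fun setT
  (fun z : measurableTypeR R * measurableTypeR R => h z.1 z.2).
Proof. exact: (measurable_hit alpha measurable_M). Qed.

Let g0E tau : 0 < tau -> g0 tau = g tau.
Proof. by move=> t0; rewrite /g0 patchE mem_setE in_itv/= t0. Qed.

Let dens0E t tau : 0 < tau -> dens0 dens t tau = dens t tau.
Proof. by move=> t0; rewrite /dens0 patchE mem_setE in_itv/= t0. Qed.

Let measurable_fr := measurable_fracint alpha_gt0 M_ge0 M_eq0 M_moments.

Let integral_fracint_dens t (G : R -> R) : 0 < t ->
  measurableR G ->
  (\int[mu]_(tau in Rpos) ((G tau)%:E * fracint alpha M (1 - alpha) t tau)
   = \int[mu]_(tau in Rpos) (Gamma (1 - alpha) * (dens0 dens t tau * G tau))%:E)%E.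
Proof.
move=> t0 mG; have [md d0 _] := dens_moments alpha_gt0 D t0.
apply: ae_eq_integral => //.
- by apply: measurable_funTS; apply: emeasurable_funM; [meas|exact: measurable_fr].
- by apply: measurable_funTS; meas.
- apply: ae_imp (fracint_dens alpha_gt0 alpha_lt1 D t0) => tau H.
  rewrite /= in_itv/= andbT => tau0; rewrite H// -EFinM; congr (_%:E); ring.
Qed.

Let integral_fracint_tail t (G : R -> R) : 0 < t ->
  measurableR G ->
  (\int[mu]_(tau in Rpos) ((G tau)%:E * fracint alpha M 1 t tau)
   = \int[mu]_(tau in Rpos) ((G tau)%:E * tail (dens0 dens t) tau))%E.
Proof.
move=> t0 mG; have Hd := dens_moments alpha_gt0 D t0.
apply: ae_eq_integral => //.
- by apply: measurable_funTS; apply: emeasurable_funM; [meas|exact: measurable_fr].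
- by apply: measurable_funTS; apply: emeasurable_funM; [meas|exact: (measurable_tail Hd)].
- apply: ae_imp (fracint_tail alpha_gt0 D t0) => tau H.
  by rewrite /= in_itv/= andbT => tau0; rewrite H.
Qed.

Let measurable_norm_g0 : measurableR (fun tau : R => `|g0 tau|).
Proof. exact: measurableT_comp. Qed.

Let norm_g_fracint_fin t : 0 < t ->
  (\int[mu]_(tau in Rpos) (`|g0 tau|%:E * fracint alpha M (1 - alpha) t tau) < +oo)%E.
Proof.
move=> t0; have [md d0 _] := dens_moments alpha_gt0 D t0.
rewrite integral_fracint_dens//.
under eq_integral do rewrite EFinM.
rewrite ge0_integralZl.
- rewrite lte_mul_pinfty// ?lee_fin ?(ltW (Gamma_gt0 alpha1_gt0))//.
  have /integrableP[_] := g_mean t0; apply: le_lt_trans; rewrite le_eqVlt; apply/orP;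
      left; apply/eqP.
  apply: eq_integral => tau; rewrite inE/= in_itv/= andbT => tau0.
  by rewrite normrM g0E// -dens0E// (ger0_norm (d0 _)).
- exact: measurable_Rpos.
- by apply: measurable_funTS; meas.
- by move=> tau _; rewrite lee_fin mulr_ge0.
- by rewrite lee_fin ltW// Gamma_gt0.
Qed.

(** Absolute convergence for order 1 follows from that for order 1 - alpha,
    because 1 <= t^alpha (t - s)^(-alpha) for 0 < s < t. *)
Let norm_g_fracint1_fin t : 0 < t ->
  (\int[mu]_(tau in Rpos) (`|g0 tau|%:E * fracint alpha M 1 t tau) < +oo)%E.
Proof.
move=> t0.
have mk b tau : measurableR (fun s : R => (t - s) `^ (b - 1) * h tau s).
  exact: (measurable_fun_pair2 tau (measurable_fracint_kernel M_moments b t)).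
have mg0 : measurableR (fun tau : R => `|g0 tau|%:E).
  exact/measurable_EFinP.
apply: (@le_lt_trans _ _ ((t `^ alpha)%:E *
    \int[mu]_(tau in Rpos) (`|g0 tau|%:E * fracint alpha M (1 - alpha) t tau))%E);
        last first.
  by rewrite lte_mul_pinfty ?lee_fin ?powR_ge0// norm_g_fracint_fin.
rewrite -ge0_integralZl; [|exact: measurable_Rpos| | |]; last 3 first.
- by apply: measurable_funTS; apply: emeasurable_funM.
- by move=> tau _; rewrite mule_ge0 ?lee_fin ?fracint_ge0.
- by rewrite lee_fin powR_ge0.
apply: ge0_le_integral => //.
- by move=> tau _; rewrite mule_ge0 ?lee_fin ?fracint_ge0.
- by apply: measurable_funTS; apply: emeasurable_funM.
- by apply: measurable_funTS; apply: emeasurable_funM => //; apply: emeasurable_funM.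
move=> tau _; rewrite muleCA lee_wpmul2l ?lee_fin// /fracint -ge0_integralZl.
- apply: ge0_le_integral.
  + exact: measurable_itv.
  + by move=> s _; rewrite lee_fin mulr_ge0 ?powR_ge0.
  + by apply: measurable_funTS; apply/measurable_EFinP; exact: mk.
  + apply: measurable_funTS; have mks := mk (1 - alpha) tau; rewrite -/h.
    by under eq_fun do rewrite -EFinM; apply/measurable_EFinP; apply: measurable_funM.
  + move=> s; rewrite /= in_itv/= => /andP[s0 st].
    rewrite -EFinM lee_fin subrr powRr0 [leRHS]mulrA ler_wpM2r//.
    have ts0 : 0 < t - s by rewrite subr_gt0.
    rewrite (_ : 1 - alpha - 1 = - alpha); last by ring.
    rewrite powRN ler_pdivlMr ?powR_gt0// mul1r.
    rewrite ge0_ler_powR ?nnegrE ?(ltW alpha_gt0) ?(ltW ts0) ?(ltW t0)//.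
    by rewrite lerBlDr lerDl ltW.
- exact: measurable_itv.
- by apply: measurable_funTS; apply/measurable_EFinP; exact: mk.
- by move=> s _; rewrite lee_fin mulr_ge0 ?powR_ge0.
- by rewrite lee_fin powR_ge0.
Qed.

Let measurable_dens0 t : 0 < t -> measurableR (dens0 dens t).
Proof. by move=> t0; have [] := dens_moments alpha_gt0 D t0. Qed.

(** This turns out to be the derivative in time of the mean of [f]. *)
Definition psi (s : R) : R := \int[mu]_(tau in Rpos) (g0 tau * h tau s).

Let psi_integral t : 0 < t ->
  [/\ mu.-integrable `]0%R, t[ (fun s => (psi s)%:E),
      {ae @lebesgue_measure R, forall s, 0 < s < t ->
        mu.-integrable Rpos (fun tau => (g0 tau * h tau s)%:E)}
    & (\int[mu]_(s in `]0%R, t[) (psi s)%:E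
       = \int[mu]_(tau in Rpos) ((g0 tau)%:E * tail (dens0 dens t) tau))%E].
Proof.
move=> t0.
have E tau : (\int[mu]_(s in `]0%R, t[) (h tau s)%:E)%E = fracint alpha M 1 t tau.
  by apply: eq_integral => s _; rewrite subrr powRr0 mul1r.
have [||||||i ia I] := @fubini_weight R Rpos `]0%R, t[ g0 h.
- exact: measurable_Rpos.
- exact: measurable_itv.
- exact: measurable_g0.
- exact: measurable_h.
- exact: h_ge0.
- under eq_integral do rewrite E; exact: norm_g_fracint1_fin.
split; first exact: i.
- by apply: ae_imp ia => s H st; apply: H; rewrite /= in_itv.
- rewrite -(integral_fracint_tail t0 measurable_g0); apply: (eq_trans I).
  by apply: eq_integral => tau _; rewrite E.
Qed.

(** Exchanging the integrals leaves the fractional integral of the passage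
    density, which is the density of the internal time. *)
Let psi_caputo t : 0 < t ->
  measurable_fun (`]0%R, t[ : set (measurableTypeR R))
    (fun s => ((t - s) `^ (- alpha) * psi s)%:E) /\
  (\int[mu]_(s in `]0%R, t[) ((t - s) `^ (- alpha) * psi s)%:E
   = (Gamma (1 - alpha) * internal_mean dens g t)%:E)%E.
Proof.
move=> t0; have [md d0 _] := dens_moments alpha_gt0 D t0.
have [ipsi ia _] := psi_integral t0.
have mpsi : measurable_fun (`]0%R, t[ : set (measurableTypeR R))
    (fun s => ((t - s) `^ (- alpha) * psi s)%:E).
  apply/measurable_EFinP; apply: measurable_funM.
    by apply: measurable_funTS; meas.
  by apply/measurable_EFinP; exact: measurable_int ipsi.
split; first exact: mpsi.
pose w tau s := (t - s) `^ (1 - alpha - 1) * h tau s.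
have [||||||i _ I] := @fubini_weight R Rpos `]0%R, t[ g0 w.
- exact: measurable_Rpos.
- exact: measurable_itv.
- exact: measurable_g0.
- exact: (measurable_fracint_kernel M_moments (1 - alpha) t).
- by move=> tau s; rewrite mulr_ge0 ?powR_ge0.
- exact: norm_g_fracint_fin.
transitivity (\int[mu]_(s in `]0%R, t[) (\int[mu]_(tau in Rpos) (g0 tau * w tau s))%:E)%E.
  apply: ae_eq_integral.
  - exact: measurable_itv.
  - exact: mpsi.
  - exact: measurable_int i.
  - apply: ae_imp ia => s H; rewrite /= in_itv/= => st; congr (_%:E).
    rewrite /psi -RintegralZl//; last exact: H.
    apply: eq_Rintegral => tau _; rewrite /w (_ : 1 - alpha - 1 = - alpha); last by ring.
    by rewrite mulrCA.
apply: (eq_trans I); apply: (eq_trans (integral_fracint_dens t0 measurable_g0)).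
transitivity ((Gamma (1 - alpha))%:E * \int[mu]_(tau in Rpos) (dens t tau * g tau)%:E)%E.
  rewrite -integralZl; [|exact: measurable_Rpos|exact: g_mean].
  apply: eq_integral => tau; rewrite inE/= in_itv/= andbT => tau0.
  by rewrite g0E// dens0E// -EFinM.
rewrite EFinM; congr (_ * _)%E; rewrite /internal_mean t0 fineK//.
by apply: integrable_fin_num; [exact: measurable_Rpos|exact: g_mean].
Qed.

Let integral_g y : 0 < y -> (\int[mu]_(tau in `]0%R, y[) (g tau)%:E = (f y - f 0)%:E)%E.
Proof.
move=> y0.
have gy : {within `[0, y], continuous g}.
  by apply: continuous_subspaceW g_cont; apply: subset_itvl; rewrite bnd_simp.
have [fc f0c] := (continuous_within_itvcyP 0 f).1 f_cont.
have mg : measurable_fun (`[0, y] : set R) (fun tau => (g tau)%:E).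
  by apply/measurable_EFinP; apply: subspace_continuous_measurable_fun.
rewrite integral_itv_bndo_bndc; last first.
  by apply: measurable_funS mg => //; apply: subset_itv; rewrite bnd_simp.
rewrite integral_itv_obnd_cbnd; last first.
  by apply: measurable_funS mg => //; apply: subset_itvr; rewrite bnd_simp.
rewrite (continuous_FTC2 (F := f) y0 gy) -?EFinB//.
- split.
  + by move=> x; rewrite in_itv/= => /andP[x0 _]; have [] := f_derive x0.
  + exact: f0c.
  + apply: cvg_at_left_filter; apply: differentiable_continuous.
    by apply/derivable1_diffP; have [] := f_derive y0.
- move=> x; rewrite in_itv/= => /andP[x0 _]; rewrite derive1E.
  by have H := f_derive x0; rewrite derive_val.
Qed.

(** E f(S(t)) - f 0 is the mean of the integral of [g] over ]0, S(t)[, that is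
    the integral of g(tau) P(S(t) > tau). *)
Let psi_mean t : 0 < t -> internal_mean dens f t - f 0 = \int[mu]_(s in `]0%R, t[) psi s.
Proof.
move=> t0; have [md d0 _] := dens_moments alpha_gt0 D t0.
have Hd := dens_moments alpha_gt0 D t0.
have [_ _ I] := psi_integral t0; rewrite /Rintegral I.
pose w (tau y : R) : R := if tau < y then dens0 dens t y else 0.
have w_tail tau : 0 < tau -> (\int[mu]_(y in Rpos) (w tau y)%:E)%E
    = tail (dens0 dens t) tau.
  move=> tau0; rewrite /tail (itv_oy_Rpos (ltW tau0)) integral_mkcondr;
      apply: eq_integral => y _.
  by rewrite patchE mem_setE in_itv/= andbT /w; case: ifP.
have [||||||_ _ J] := @fubini_weight R Rpos Rpos g0 w.
- exact: measurable_Rpos.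
- exact: measurable_Rpos.
- exact: measurable_g0.
- apply: measurable_fun_ifT; [by apply: measurable_fun_ltr; meas| |by meas].
  by apply: (measurableT_comp (measurable_dens0 t0)); exact: measurable_snd.
- by move=> tau y; rewrite /w; case: ifP.
- have := norm_g_fracint1_fin t0; rewrite (integral_fracint_tail t0 measurable_norm_g0).
  apply: le_lt_trans; rewrite le_eqVlt; apply/orP; left; apply/eqP; apply: eq_integral.
  by move=> tau; rewrite inE/= in_itv/= andbT => tau0; rewrite w_tail.
rewrite (_ : (\int[mu]_(tau in Rpos) ((g0 tau)%:E * tail (dens0 dens t) tau))%E =
   (\int[mu]_(tau in Rpos) ((g0 tau)%:E * \int[mu]_(y in Rpos) (w tau y)%:E))%E);
       last first.
  by apply: eq_integral => tau; rewrite inE/= in_itv/= andbT => tau0; rewrite w_tail.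
rewrite -[X in fine X]J.
have [_ _ d1 _] := D t0.
have id : mu.-integrable Rpos (fun y => (dens t y)%:E).
  apply: eq_integrable (has_moments_integrable Hd); first exact: measurable_Rpos.
  by move=> y; rewrite inE/= in_itv/= andbT => y0; rewrite dens0E.
have idf : mu.-integrable Rpos (fun y => (dens t y * f 0)%:E).
  by have := integrableZr measurable_Rpos (f 0) id.
transitivity (\int[mu]_(y in Rpos) (dens t y * f y - dens t y * f 0)).
  rewrite RintegralB//; [|exact: f_mean].
  have -> : \int[mu]_(y in Rpos) (dens t y * f 0) = f 0.
    rewrite RintegralZr; [|exact: measurable_Rpos|exact: id].
    by rewrite (_ : \int[mu]_(y in Rpos) dens t y = 1) ?mul1r// /Rintegral d1.
  by rewrite /internal_mean t0.
apply: eq_Rintegral => y; rewrite inE/= in_itv/= andbT => y0.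
rewrite -mulrBr {1}/Rintegral.
have -> : (\int[mu]_(tau in Rpos) (g0 tau * w tau y)%:E =
    (dens t y)%:E * \int[mu]_(tau in `]0%R, y[) (g tau)%:E)%E.
  transitivity (\int[mu]_(tau in `]0%R, y[) ((dens t y)%:E * (g tau)%:E))%E; last first.
    rewrite integralZl; [by []|exact: measurable_itv|].
    have ig : mu.-integrable (`[0%R, y]%classic : set R) (EFin \o g).
      apply: continuous_compact_integrable; first exact: segment_compact.
      by apply: continuous_subspaceW g_cont; apply: subset_itvl; rewrite bnd_simp.
    apply: integrableS ig; [exact: measurable_itv|exact: measurable_itv|].
    by apply: subset_itv; rewrite bnd_simp.
  rewrite itv_0o_Rpos integral_mkcondr; apply: eq_integral => tau;
      rewrite inE/= in_itv/= andbT => tau0.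
  rewrite patchE mem_setE in_itv/= /w g0E//; case: ifP => _; last by rewrite mulr0.
  by rewrite dens0E// -EFinM mulrC.
by rewrite integral_g.
Qed.

(** Lebesgue differentiation of [psi_mean]. *)
Let derive_internal_mean t : {ae @lebesgue_measure R, forall s, 0 < s < t ->
  derive1 (internal_mean dens f) s = psi s}.
Proof.
have [t0|t0] := leP t 0.
  by apply: aeW => s /andP[s0 /(lt_trans s0)]; rewrite ltNge t0.
have [i _ _] := psi_integral t0.
pose w := psi \_ (`]0%R, t[%classic : set R).
have mI : measurable (`]0%R, t[%classic : set (measurableTypeR R)) by exact: measurable_itv.
have iw : mu.-integrable setT (EFin \o w).
  have := @integrable_mkcond _ _ R mu `]0%R, t[%classic (EFin \o psi) mI.
  by rewrite restrict_EFin => -[+ _]; apply; exact: i.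
have locw : locally_integrable [set: R] w.
  by apply: integrable_locally i; exact: measurable_itv.
have iwy (y : R) : mu.-integrable `]-oo, y] (EFin \o w).
  by apply: integrableS iw => //; exact: measurable_itv.
have := FTC1Ny iwy locw; set F := fun x : R => _.
have FE r : 0 < r -> r < t -> F r = internal_mean dens f r - f 0.
  move=> r0 rt; rewrite psi_mean// /F /w -Rintegral_mkcondr.
  have [ir _ _] := psi_integral r0.
  rewrite Rintegral_itv_bndo_bndc; last exact: ir.
  congr (Rintegral _ _ _); apply/seteqP; split=> x/=; rewrite !in_itv/=.
    by move=> [-> /andP[->]].
  by move=> /andP[x0 xr]; rewrite x0 xr (le_lt_trans xr rt).
apply: ae_imp => s [dF dFs] /andP[s0 st].
have -> : psi s = w s by rewrite /w patchE mem_setE in_itv/= s0 st.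
rewrite -dFs !derive1E.
have -> : 'D_1 (internal_mean dens f) s = 'D_1 (F + cst (f 0)) s.
  apply: near_eq_derive; near=> r.
  have -> : (F + cst (f 0)) r = F r + f 0 by [].
  rewrite FE ?subrK//.
    by near: r; exact: lt_nbhsr.
  by near: r; exact: lt_nbhsl.
by rewrite deriveD; [rewrite derive_cst addr0|exact: dF|exact: derivable_cst].
Unshelve. all: by end_near. Qed.

(** The derivative of the mean is identified for almost every [s] only; its
    measurability, which cannot be deduced from that, is assumed. *)
Lemma caputo_internal_mean t : 0 < t ->
  measurable_fun (`]0%R, t[ : set (measurableTypeR R))
    (fun s => ((t - s) `^ (- alpha) * derive1 (internal_mean dens f) s)%:E) ->
  caputo 0 alpha (internal_mean dens f) t = internal_mean dens g t.
Proof.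
move=> t0 md; have [mp E] := psi_caputo t0.
rewrite /caputo /Rintegral (_ : (\int[mu]_(x in _) _)%E
    = (Gamma (1 - alpha) * internal_mean dens g t)%:E).
  by rewrite /= mulrA mulVf ?mul1r// gt_eqF// Gamma_gt0.
rewrite -E; apply: ae_eq_integral; [exact: measurable_itv|exact: md|exact: mp|].
apply: ae_imp (derive_internal_mean t) => s H; rewrite /= in_itv/= => st.
by rewrite H.
Qed.

End CaputoInternalMean.

(** * The natural Lagrangian and Hamiltonian *)

Lemma is_derive_quadratic (R : realType) (c d v : R) :
  is_derive v 1 (fun z => c * z ^+ 2 + d) (c * (2 * v)).
Proof.
have H := is_deriveD (is_deriveZ c (is_deriveX 2 (is_derive_id v 1))) (is_derive_cst d v 1).
apply: (is_derive_eq H).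
by rewrite addr0 /GRing.scale/= mulr1 expr1.
Qed.

Lemma partial2_Lagrangian (R : realType) (m : R) (U : R -> R) (u v : R) :
  partial2 (natural_Lagrangian m U) u v = m * v.
Proof.
rewrite /partial2 /natural_Lagrangian derive1E.
have H := is_derive_quadratic (2^-1 * m) (- U u) v.
by rewrite derive_val; field.
Qed.

Lemma partial2_Hamiltonian (R : realType) (m : R) (U : R -> R) (u v : R) : m != 0 ->
  partial2 (natural_Hamiltonian m U) u v = m^-1 * v.
Proof.
move=> m0; rewrite /partial2 /natural_Hamiltonian derive1E.
have H := is_derive_quadratic ((2 * m)^-1) (U u) v.
by rewrite derive_val; field.
Qed.

Lemma partial1_Hamiltonian (R : realType) (m : R) (U : R -> R) (u v : R) :
  derivable U u 1 -> partial1 (natural_Hamiltonian m U) u v = derive1 U u.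
Proof.
move=> dU; rewrite /partial1 /natural_Hamiltonian !derive1E.
have := @deriveD _ _ _ (cst ((2 * m)^-1 * v ^+ 2)) U u 1 (derivable_cst _ _ _) dU.
by rewrite derive_cst add0r.
Qed.

Lemma partial1_Lagrangian (R : realType) (m : R) (U : R -> R) (u v : R) :
  derivable U u 1 -> partial1 (natural_Lagrangian m U) u v = - derive1 U u.
Proof.
move=> dU; rewrite /partial1 /natural_Lagrangian !derive1E.
have := @deriveB _ _ _ (cst (2^-1 * m * v ^+ 2)) U u 1 (derivable_cst _ _ _) dU.
by rewrite derive_cst sub0r.
Qed.

Lemma has_internal_meanZ (R : realType) (dens : R -> R -> R) (f : R -> R) (c : R) :
  has_internal_mean dens f -> has_internal_mean dens (fun tau => c * f tau).
Proof.
move=> Hf t t0; have mD : measurable (Rpos : set (measurableTypeR R)).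
  exact: measurable_itv.
have := integrableZl mD c (Hf t t0); apply: eq_integrable => //.
by move=> tau _; rewrite -EFinM mulrCA.
Qed.

Lemma internal_meanZ (R : realType) (dens : R -> R -> R) (f : R -> R) (c t : R) : 0 < t ->
  has_internal_mean dens f ->
  internal_mean dens (fun tau => c * f tau) t = c * internal_mean dens f t.
Proof.
move=> t0 Hf; rewrite /internal_mean t0 -RintegralZl; [|exact: measurable_itv|exact: Hf].
by apply: eq_Rintegral => tau _; rewrite mulrCA.
Qed.

Lemma eq_derive1_pos (R : realType) (y z : R -> R) (s : R) : 0 < s ->
  (forall r, 0 < r -> y r = z r) -> derive1 y s = derive1 z s.
Proof.
move=> s0 yz; rewrite !derive1E; apply: near_eq_derive; near=> r; apply: yz.
by near: r; exact: lt_nbhsr.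
Unshelve. all: by end_near. Qed.

Lemma eq_caputo_integrand (R : realType) (alpha t : R) (y z : R -> R) :
  (forall r, 0 < r -> y r = z r) ->
  {in `]0%R, t[%classic, (fun s => ((t - s) `^ (- alpha) * derive1 y s)%:E) =1
     (fun s => ((t - s) `^ (- alpha) * derive1 z s)%:E)}.
Proof.
move=> yz s; rewrite inE/= in_itv/= => /andP[s0 _].
by rewrite (eq_derive1_pos s0 yz).
Qed.

Lemma eq_caputo (R : realType) (alpha t : R) (y z : R -> R) :
  (forall r, 0 < r -> y r = z r) -> caputo 0 alpha y t = caputo 0 alpha z t.
Proof.
move=> yz; rewrite /caputo; apply: congr1; apply: eq_Rintegral => s.
by rewrite inE/= in_itv/= => /andP[s0 _]; rewrite (eq_derive1_pos s0 yz).
Qed.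

Unset Implicit Arguments.
Theorem theorem8 (R : realType) (alpha m : R) (U : R -> R)
    (dens : R -> R -> R) (x p : R -> R) :
  let L := natural_Lagrangian m U in
  let H := natural_Hamiltonian m U in
  let x_alpha := internal_mean dens x in
  let p_alpha := internal_mean dens p in
  0 < alpha -> alpha < 1 ->
  0 < m -> smooth U ->
  internal_time_density alpha dens ->
  Hamilton_solution H x p ->
  has_internal_mean dens x ->
  has_internal_mean dens p ->
  has_internal_mean dens (fun tau => partial1 H (x tau) (p tau)) ->
  causal_Euler_Lagrange_solution alpha L x_alpha ->
  forall t : R, 0 < t ->
    partial1 H (x_alpha t) (p_alpha t)
      = \int[@lebesgue_measure R]_(tau in `]0, +oo[)
          (dens t tau * partial1 H (x tau) (p tau))
    /\
    partial2 H (x_alpha t) (p_alpha t)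
      = \int[@lebesgue_measure R]_(tau in `]0, +oo[)
          (dens t tau * partial2 H (x tau) (p tau)).
Proof.
move=> L H x_alpha p_alpha a0 a1 m0 sU D [xc pc HS] mx mp mH [ex emom EL].
have m_neq0 : m != 0 by rewrite gt_eqF.
have dU u : derivable U u 1 := sU 0%N u.
have p2H u v : partial2 H u v = m^-1 * v by exact: partial2_Hamiltonian.
have p1H u v : partial1 H u v = derive1 U u by exact: partial1_Hamiltonian.
have cU' : continuous (derive1 U).
  move=> u; apply: differentiable_continuous; apply/derivable1_diffP; exact: sU 1%N u.
have cg : {within `[0, +oo[, continuous (fun tau => -1 * partial1 H (x tau) (p tau))}.
  rewrite (_ : (fun tau => _) = (fun tau => -1 * derive1 U (x tau))); last first.
    by apply/funext => tau; rewrite p1H.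
  move=> tau; apply: cvgMr; apply: continuous_comp; first exact: xc.
  exact: cU'.
have cq : {within `[0, +oo[, continuous (fun tau => m^-1 * p tau)}.
  by move=> tau; apply: cvgMr; exact: pc.
have dx (s : R) : 0 < s -> is_derive s 1 x (m^-1 * p s).
  by move=> s0; have [+ _] := HS s s0; rewrite p2H.
have dp (s : R) : 0 < s -> is_derive s 1 p (-1 * partial1 H (x s) (p s)).
  by move=> s0; have [_ +] := HS s s0; rewrite mulN1r.
have Dx s : 0 < s -> caputo 0 alpha x_alpha s = m^-1 * p_alpha s.
  move=> s0; rewrite -internal_meanZ//.
  apply: (caputo_internal_mean a0 a1 D xc cq dx mx (has_internal_meanZ m^-1 mp) s0).
  by have [_ /measurable_int] := ex s s0.
pose mom s := partial2 L (x_alpha s) (caputo 0 alpha x_alpha s).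
have momE s : 0 < s -> mom s = p_alpha s.
  by move=> s0; rewrite /mom partial2_Lagrangian Dx// mulrA mulfV ?mul1r.
move=> t t0; split; last first.
  transitivity (internal_mean dens (fun tau => m^-1 * p tau) t).
    by rewrite p2H internal_meanZ.
  by rewrite /internal_mean t0; apply: eq_Rintegral => tau _; rewrite p2H.
have := EL t t0; rewrite partial1_Lagrangian// -/mom (eq_caputo _ _ momE).
rewrite (caputo_internal_mean a0 a1 D pc cg dp mp (has_internal_meanZ (-1) mH) t0);
    last first.
  have [_ /measurable_int] := emom t t0.
  by apply: eq_measurable_fun => s st; rewrite -(eq_caputo_integrand alpha momE st).
rewrite internal_meanZ// mulN1r opprK p1H => /eqP; rewrite addrC subr_eq0 => /eqP <-.
by rewrite /internal_mean t0.
Qed.
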